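(* Let $k\ge 3$ be an integer and let $a,b$ be real numbers with $a\in(0,1)$, $b\in(0,1)$, $b>2a$, $b^2>a$ and $\left\lceil \frac{b-a}{b^2-a}\right\rceil<k$. Then $$\zeta_{\rm clique}(k)\ge \frac{(b-a)^{b-a}(1-b+a)^{1-b+a}}{b^b(1-b)^{1-b}}.$$
   Context: A distance graph in $\mathbb{R}^n$ is a graph $G=(V,E)$ with $V\subseteq\mathbb{R}^n$ and, for some real $a>0$, $E\subseteq\{\{x,y\}: x,y\in V,\ |x-y|=a\}$ (Euclidean norm). $\chi(G)$ is the chromatic number and $\omega(G)$ the clique number. For an integer $k$, $\zeta_{\rm clique}(k)$ is the supremum of all real $\zeta$ for which there exists a function $\delta(n)\to 0$ ($n\to\infty$) such that for every $n$ there is a distance graph $G$ in $\mathbb{R}^n$ with $\omega(G)<k$ and $\chi(G)\ge(\zeta+\delta(n))^n$. *)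

(* Defs.v *)
From mathcomp Require Import all_boot all_order all_algebra.
From mathcomp Require Import all_classical all_reals all_analysis.

Set Implicit Arguments.
Unset Strict Implicit.
Unset Printing Implicit Defensive.
Import Order.TTheory GRing.Theory Num.Theory.
Import numFieldNormedType.Exports.

Local Open Scope classical_set_scope.
Local Open Scope ring_scope.

(* The library norm `|x| on 'rV[R]_n is the sup norm, not the Euclidean one. *)
Definition enorm (R : realType) (n : nat) (x : 'rV[R]_n) : R :=
  Num.sqrt (\sum_(i < n) x ord0 i ^+ 2).

Record graph (T : Type) := Graph {
  vertices : set T;
  edges : set (set T)
}.

Definition distance_graph (R : realType) (n : nat) (G : graph 'rV[R]_n) : Prop :=
  exists2 a : R, 0 < a &
    edges G `<=` [set e | exists x y : 'rV[R]_n,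
      [/\ vertices G x, vertices G y, enorm (x - y) = a & e = [set x; y]]].

(* Colours are naturals below m rather than elements of 'I_m, so that the
   graph without vertices is 0-colourable even when T is inhabited. *)
Definition colorable (T : Type) (G : graph T) (m : nat) : Prop :=
  exists2 c : T -> nat, (forall x, vertices G x -> (c x < m)%N) &
    forall x y, vertices G x -> vertices G y -> edges G [set x; y] -> c x <> c y.

(* +oo when there is no proper colouring with finitely many colours. *)
Definition chromatic_number (R : realType) (T : Type) (G : graph T) : \bar R :=
  ereal_inf [set (m%:R)%:E | m in [set m : nat | colorable G m]].

Definition clique (T : Type) (G : graph T) (K : set T) : Prop :=
  K `<=` vertices G /\
  forall x y, K x -> K y -> x <> y -> edges G [set x; y].

(* +oo when there are arbitrarily large finite cliques. *)
Definition clique_number (R : realType) (T : Type) (G : graph T) : \bar R :=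
  ereal_sup [set (m%:R)%:E | m in
    [set m : nat | exists2 K : set T, clique G K & (K #= `I_m)%card]].

Definition zeta_clique (R : realType) (k : int) : \bar R :=
  ereal_sup [set z%:E | z in [set z : R |
    exists2 delta : nat -> R, delta n @[n --> \oo] --> (0 : R) &
      forall n : nat, (0 < n)%N ->
        exists G : graph 'rV[R]_n,
          [/\ distance_graph G,
              (clique_number R G < (k%:~R)%:E)%E &
              (((z + delta n) ^+ n)%:E <= chromatic_number R G)%E]]].

(* Main.v *)
(* In dimension n take the 0/1 vectors with w = floor(b n) ones, adjacent when their supports
   A, B satisfy |A \ B| = q, where q is a prime power slightly below (b - a) n.  As w < 2 q,
   an independent set is a family of sets with |A \ B| never a nonzero multiple of q, so by
   Frankl-Wilson it has at most sum_(i < q) C(n, i) elements; comparing with C(n, w) gives the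
   chromatic number.  Cliques are bounded by Cauchy-Schwarz applied to the sum of the vectors.

   The clique bound requires q = (b - a) n (1 - o(1)) for every n, hence prime powers in
   (X, (1 + c) X] for each c > 0 and all large X.  This is obtained as in Erdos' 1949 paper:
   Selberg's formula bounds psi(z) - psi(y) by 2 (z - y) + o(y), and if (X, (1 + c) X] contains no
   prime power it also forces, for almost all m (with weight Lambda(m) / m), the interval
   (X / m, (1 + c) X / m] to carry that maximal mass 2 c X / m.  Applying m |-> X / m twice along
   such m shows that psi has almost density 2 just below a typical m; iterating this produces a
   long interval of density at least 3/2, contradicting Mertens' estimate. *)

Require Import Defs.
From mathcomp Require Import all_boot all_order all_algebra.
From mathcomp Require Import all_classical all_reals all_analysis.
From mathcomp Require Import ring lra zify.

Set Implicit Arguments.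
Unset Strict Implicit.
Unset Printing Implicit Defensive.
Import Order.TTheory GRing.Theory Num.Theory.
Import numFieldNormedType.Exports.

Local Open Scope classical_set_scope.
Local Open Scope ring_scope.

(** * The von Mangoldt and Moebius functions *)

Lemma sum_dvd_widen (V : nmodType) (F : nat -> V) (m N : nat) :
  (0 < m <= N)%N ->
  \sum_(1 <= d < N.+1 | (d %| m)%N) F d = \sum_(1 <= d < m.+1 | (d %| m)%N) F d.
Proof.
move=> /andP[m0 mN]; rewrite (@big_cat_nat _ _ _ m.+1) //=.
rewrite [X in _ + X]big_nat_cond [X in _ + X]big1 ?addr0 // => i.
by move=> /andP[/andP[mi _] /dvdn_leq -/(_ m0)]; rewrite leqNgt mi.
Qed.

Lemma sum_multiples (V : nmodType) (G : nat -> V) (d N : nat) : (0 < d)%N ->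
  \sum_(1 <= n < (N %/ d).+1) G (d * n)%N = \sum_(1 <= m < N.+1 | (d %| m)%N) G m.
Proof.
move=> d0; elim: N => [|N IH]; first by rewrite div0n !big_geq.
rewrite divnS // [RHS]big_mkcond big_nat_recr //= -big_mkcond -IH.
case: ifPn => dN; rewrite ?add0n ?addr0 // add1n big_nat_recr //=; congr (_ + G _).
by rewrite -[RHS](divnK dN) divnS // dN add1n mulnC.
Qed.

Lemma exchange_sum_dvd (V : nmodType) (f : nat -> nat -> V) (N : nat) :
  \sum_(1 <= d < N.+1) \sum_(1 <= n < (N %/ d).+1) f d (d * n)%N =
  \sum_(1 <= m < N.+1) \sum_(1 <= d < m.+1 | (d %| m)%N) f d m.
Proof.
under eq_big_nat => d /andP[d0 _].
  rewrite (sum_multiples (f d) N d0) big_mkcond; over.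
rewrite exchange_big_nat /=; apply: eq_big_nat => m /andP[m0 mN].
by rewrite -big_mkcond sum_dvd_widen // m0.
Qed.

(** Both sides run over the pairs with [d * e] dividing [m], a condition symmetric in [d] and
    [e]. *)
Lemma exchange_sum_divisors (V : nmodType) (f : nat -> nat -> V) (m : nat) :
  (0 < m)%N ->
  \sum_(1 <= d < m.+1 | (d %| m)%N) \sum_(1 <= e < (m %/ d).+1 | (e %| m %/ d)%N) f d e =
  \sum_(1 <= e < m.+1 | (e %| m)%N) \sum_(1 <= d < (m %/ e).+1 | (d %| m %/ e)%N) f d e.
Proof.
move=> m0.
have aux (g : nat -> nat -> V) :
    \sum_(1 <= d < m.+1 | (d %| m)%N) \sum_(1 <= e < (m %/ d).+1 | (e %| m %/ d)%N) g d e
    = \sum_(1 <= d < m.+1) \sum_(1 <= e < m.+1) if (d * e %| m)%N then g d e else 0.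
  rewrite big_mkcond; apply: eq_big_nat => d /andP[d0 dm].
  case: ifPn => dvm; last first.
    rewrite big1 // => e _; case: ifPn => // /(dvdn_trans (dvdn_mulr _ (dvdnn d))).
    by rewrite (negPf dvm).
  rewrite -(@sum_dvd_widen _ _ _ m); last first.
    by rewrite divn_gt0 // (dvdn_leq m0 dvm) leq_div.
  rewrite big_mkcond; apply: eq_big_nat => e _.
  by rewrite mulnC dvdn_divRL.
rewrite aux exchange_big_nat (aux (fun e d => f d e)) /=.
by apply: eq_bigr => e _; apply: eq_bigr => d _; rewrite mulnC.
Qed.

Section ArithmeticFunctions.
Context {R : realType}.

(** The test asks whether [n] is a power of its least prime factor. Since [pdiv 1] is 1, the value
    at 1 is [ln 1], that is 0. *)
Definition vonmangoldt (n : nat) : R :=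
  if n == (pdiv n ^ logn (pdiv n) n)%N then ln (pdiv n)%:R else 0.

Lemma vonmangoldt_ge0 n : 0 <= vonmangoldt n.
Proof.
rewrite /vonmangoldt; case: ifP => // _; apply: ln_ge0.
by rewrite ler1n pdiv_gt0.
Qed.

Lemma vonmangoldt1 : vonmangoldt 1 = 0.
Proof. by rewrite /vonmangoldt /= ln1. Qed.

Lemma vonmangoldt_prime_power p k : prime p -> (0 < k)%N ->
  vonmangoldt (p ^ k) = ln p%:R.
Proof.
by case: k => // k pp _; rewrite /vonmangoldt pdiv_pfactor // pfactorK // eqxx.
Qed.

Lemma vonmangoldt_neq0 n : vonmangoldt n != 0 ->
  exists p k, [/\ prime p, (0 < k)%N & n = (p ^ k)%N].
Proof.
rewrite /vonmangoldt; case: ifP => [/eqP nE|]; last by rewrite eqxx.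
move=> ln0.
have n1 : (1 < n)%N.
  by case: n nE ln0 => [|[|n]] // _; rewrite ln1 eqxx.
have pp := pdiv_prime n1.
exists (pdiv n), (logn (pdiv n) n); split=> //.
by rewrite logn_gt0 mem_primes pp pdiv_dvd (ltnW n1).
Qed.

(** Induction, removing the least prime factor [p]. Among the divisors of [m] that do not divide
    [m %/ p], the only prime power is [p ^ K], with [K] the exponent of [p] in [m]; it contributes
    the missing [ln p]. *)
Lemma sum_vonmangoldt m : (0 < m)%N ->
  \sum_(1 <= d < m.+1 | (d %| m)%N) vonmangoldt d = ln m%:R.
Proof.
elim/ltn_ind: m => m IH m0.
have [m1|m1] := leqP m 1.
  have -> : m = 1%N by lia.
  by rewrite big_mkcond big_nat1 /= ln1 vonmangoldt1.
set p := pdiv m; have pp : prime p by rewrite pdiv_prime.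
have pm : (p %| m)%N by rewrite pdiv_dvd.
have mE := divnK pm; set m' := (m %/ p)%N in mE.
have m'0 : (0 < m')%N by rewrite divn_gt0 ?prime_gt0 // dvdn_leq.
have m'm : (m' < m)%N by rewrite -mE ltn_Pmulr // prime_gt1.
have -> : ln m%:R = ln m'%:R + ln p%:R :> R.
  by rewrite -{1}mE natrM lnM ?posrE ?ltr0n ?(prime_gt0 pp).
rewrite -(IH m' m'm m'0) -(@sum_dvd_widen _ _ m' m); last by rewrite m'0 ltnW.
set K := logn p m.
have K0 : (0 < K)%N by rewrite logn_gt0 mem_primes pp pm m0.
have pKm : (p ^ K %| m)%N by rewrite pfactor_dvdn.
have logm' : logn p m' = K.-1 by rewrite /m' logn_div // (logn_prime p pp) eqxx subn1.
have pKm' : ~~ (p ^ K %| m')%N by rewrite pfactor_dvdn // logm'; lia.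
rewrite (bigID (fun d => (d %| m')%N)) /=; congr (_ + _).
  by apply: eq_bigl => d; apply/andb_idl => /dvdn_trans; apply; rewrite -mE dvdn_mulr.
rewrite -big_filter (bigD1_seq (p ^ K)%N) /= ?filter_uniq ?iota_uniq //; last first.
  rewrite mem_filter pKm pKm' mem_index_iota expn_gt0 (prime_gt0 pp) /= ltnS.
  exact: dvdn_leq.
rewrite vonmangoldt_prime_power // big_filter_cond big1 ?addr0 //.
move=> d /andP[/andP[dm dm'] dK].
apply/eqP; apply: contraNT dm' => /vonmangoldt_neq0[q [j [qp j0 dE]]].
rewrite {}dE in dm dK *.
have [qp'|qp'] := eqVneq q p.
  rewrite {}qp' {qp} in dm dK *; move: dm; rewrite pfactor_dvdn // -/K => jK.
  rewrite pfactor_dvdn // logm'.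
  by rewrite -ltnS prednK // ltn_neqAle jK andbT; apply: contra dK => /eqP ->.
move: dm; rewrite -mE Gauss_dvdl // coprimeXl //.
by rewrite prime_coprime // dvdn_prime2.
Qed.

Definition mobius (n : nat) : R :=
  if all (fun p => logn p n == 1) (primes n) then (- 1) ^+ size (primes n) else 0.

Lemma normr_mobius_le1 n : `|mobius n| <= 1.
Proof. by rewrite /mobius; case: ifP; rewrite ?normrX ?normrN1 ?expr1n ?normr0. Qed.

Lemma mobius1 : mobius 1 = 1.
Proof. by rewrite /mobius /= expr0. Qed.

Lemma mobius_primeM p e : prime p -> (0 < e)%N ->
  mobius (p * e) = if (p %| e)%N then 0 else - mobius e.
Proof.
move=> pp e0; have p0 := prime_gt0 pp; rewrite /mobius.
have memp q : (q \in primes (p * e)) = (q == p) || (q \in primes e).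
  by rewrite primesM // primes_prime // inE.
have lognpe q : logn q (p * e) = ((q == p) + logn q e)%N.
  by rewrite lognM // logn_prime.
have [pe|pe] := boolP (p %| e)%N.
  rewrite ifF //; apply: negbTE; apply/allPn; exists p; first by rewrite memp eqxx.
  by rewrite lognpe eqxx add1n eqSS -lt0n logn_gt0 mem_primes pp e0.
have pNe : p \notin primes e by rewrite mem_primes pp e0.
have permE : perm_eq (primes (p * e)) (p :: primes e).
  by apply: uniq_perm; rewrite ?cons_uniq ?pNe ?primes_uniq.
rewrite (perm_all _ permE) (perm_size permE) /= lognpe eqxx.
rewrite lognE pp e0 (negPf pe) /= exprS mulN1r.
rewrite (@eq_in_all _ _ (fun q => logn q e == 1%N)) => [|q qe].
  by case: ifP => // _; rewrite oppr0.
by rewrite lognpe; have [qp|//] := eqVneq q p; rewrite -qp qe in pNe.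
Qed.

(** With [p] the least prime factor of [m], a divisor [d] prime to [p] cancels against [p * d], and
    the multiples of [p ^ 2] contribute nothing. *)
Lemma sum_mobius m : (0 < m)%N ->
  \sum_(1 <= d < m.+1 | (d %| m)%N) mobius d = (m == 1)%:R.
Proof.
move=> m0; have [m1|m1] := leqP m 1.
  have -> : m = 1%N by lia.
  by rewrite big_mkcond big_nat1 /= mobius1.
rewrite gtn_eqF //; set p := pdiv m; have pp : prime p by rewrite pdiv_prime.
have pm : (p %| m)%N by rewrite pdiv_dvd.
have mE := divnK pm; set m' := (m %/ p)%N in mE.
have m'0 : (0 < m')%N by rewrite divn_gt0 ?prime_gt0 // dvdn_leq.
clearbody p m'; rewrite (bigID (fun d => (p %| d)%N)) /= addrC.
have -> : \sum_(1 <= d < m.+1 | (d %| m)%N && ~~ (p %| d)%N) mobius d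
    = \sum_(1 <= d < m'.+1 | (d %| m')%N) if (p %| d)%N then 0 else mobius d.
  rewrite -(@sum_dvd_widen _ _ m' m) ?m'0 -?mE ?leq_pmulr ?prime_gt0 // mE.
  rewrite big_mkcond [RHS]big_mkcond; apply: eq_bigr => d _.
  have [|pd] := boolP (p %| d)%N; first by rewrite andbF; case: ifP.
  by rewrite andbT -mE Gauss_dvdl // coprime_sym prime_coprime.
have -> : \sum_(1 <= d < m.+1 | (d %| m)%N && (p %| d)%N) mobius d
    = \sum_(1 <= d < m'.+1 | (d %| m')%N) mobius (p * d).
  rewrite (eq_bigl (fun d => (p %| d)%N && (d %| m)%N)) => [|d]; last exact: andbC.
  rewrite big_mkcondr -sum_multiples ?prime_gt0 //.
  rewrite -mE mulnK ?prime_gt0 // [RHS]big_mkcond; apply: eq_bigr => d _.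
  by rewrite mulnC dvdn_pmul2r ?prime_gt0 // mulnC.
rewrite -big_split /= big_mkcond big_nat_cond big1 // => d /andP[/andP[d0 _] _].
case: ifP => // _; rewrite mobius_primeM //; case: ifP => _; first by rewrite addr0.
by rewrite subrr.
Qed.

(** Moebius inversion of [sum_vonmangoldt]: expand each logarithm over the divisors [e] of [m %/ d]
    and exchange; the inner Moebius sum keeps only [e = m]. *)
Lemma sum_mobius_ln m : (0 < m)%N ->
  \sum_(1 <= d < m.+1 | (d %| m)%N) mobius d * ln (m%:R / d%:R) = vonmangoldt m.
Proof.
move=> m0.
transitivity (\sum_(1 <= d < m.+1 | (d %| m)%N)
    \sum_(1 <= e < (m %/ d).+1 | (e %| m %/ d)%N) mobius d * vonmangoldt e).
  rewrite big_nat_cond [RHS]big_nat_cond; apply: eq_bigr => d /andP[/andP[d0 _] dm].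
  rewrite -mulr_sumr sum_vonmangoldt; last by rewrite divn_gt0 // dvdn_leq.
  by rewrite natf_div.
rewrite (exchange_sum_divisors (fun d e => mobius d * vonmangoldt e)) //.
rewrite (eq_bigr (fun e => (m %/ e == 1)%N%:R * vonmangoldt e)) => [|e em]; last first.
  rewrite -mulr_suml sum_mobius // divn_gt0; last exact: dvdn_gt0 em.
  exact: dvdn_leq.
rewrite -big_filter (bigD1_seq m) /= ?filter_uniq ?iota_uniq //; last first.
  by rewrite mem_filter dvdnn mem_index_iota m0 /= ltnS.
rewrite divnn m0 eqxx mul1r big_filter_cond big1 ?addr0 // => e /andP[em emN].
case: eqP => [me|]; last by rewrite mul0r.
by move: emN; rewrite -(divnK em) me mul1n eqxx.
Qed.

End ArithmeticFunctions.

(** * Estimates of Chebyshev, Mertens and Selberg *)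

Section LogarithmicSums.
Context {R : realType}.
Implicit Types (N M : nat) (x y : R).

Lemma ln_le_subr1 x : 0 < x -> ln x <= x - 1.
Proof. by move=> x0; rewrite -{1}(subrKC 1 x) le_ln1Dx // ltrBrDl subrr. Qed.

Lemma ler_lnr x y : 0 < x -> x <= y -> ln x <= ln y.
Proof. by move=> x0 xy; rewrite ler_ln ?posrE // (lt_le_trans x0). Qed.

Lemma lnS_sub_le N : (0 < N)%N -> ln (N.+1%:R : R) - ln N%:R <= N%:R^-1.
Proof.
move=> N0; have N0R : 0 < N%:R :> R by rewrite ltr0n.
rewrite -ln_div ?posrE ?ltr0n //; apply: le_trans (ln_le_subr1 _) _.
  by rewrite divr_gt0 ?ltr0n.
by rewrite -addn1 natrD mulrDl mulfV ?gt_eqF //; lra.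
Qed.

Lemma lnS_sub_ge N : (0 < N)%N -> N.+1%:R^-1 <= ln (N.+1%:R : R) - ln N%:R.
Proof.
move=> N0; have N0R : 0 < N%:R :> R by rewrite ltr0n.
rewrite -opprB lerNr -ln_div ?posrE ?ltr0n //; apply: le_trans (ln_le_subr1 _) _.
  by rewrite divr_gt0 ?ltr0n.
rewrite -[N.+1]addn1 natrD.
have : (N%:R + 1) / (N%:R + 1) = 1 :> R by rewrite divff // gt_eqF ?addr_gt0.
by rewrite mulrDl; lra.
Qed.

Definition lnfact N : R := \sum_(1 <= n < N.+1) ln n%:R.

Lemma lnfactE N : lnfact N = ln N`!%:R.
Proof.
elim: N => [|N IH]; first by rewrite /lnfact big_geq // ln1.
rewrite /lnfact big_nat_recr //= -/(lnfact N) IH factS natrM mulrC.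
by rewrite lnM // posrE ltr0n ?fact_gt0.
Qed.

(** Stirling's formula up to a logarithm; the induction step only needs that [ln (N + 1) - ln N]
    lies between [1 / (N + 1)] and [1 / N]. *)
Lemma lnfact_bounds N : (0 < N)%N ->
  N%:R * ln N%:R - N%:R <= lnfact N <= N%:R * ln N%:R - N%:R + 1 + ln N%:R.
Proof.
elim: N => // -[_ _|N /(_ isT) /andP[lo hi] _].
  by rewrite /lnfact big_nat1 ln1; lra.
rewrite {1 2}/lnfact big_nat_recr //= -/(lnfact N.+1).
set n := N.+1 in lo hi *.
have n0 : 0 < n%:R :> R by rewrite ltr0n.
have up := @lnS_sub_le n isT; have dn := @lnS_sub_ge n isT.
have {}up : n%:R * (ln n.+1%:R - ln n%:R) <= 1 :> R.
  by rewrite mulrC -ler_pdivlMr // mul1r.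
have {}dn : 1 <= n.+1%:R * (ln n.+1%:R - ln n%:R) :> R.
  by rewrite mulrC -ler_pdivrMr ?ltr0n // mul1r.
have nS : n.+1%:R = n%:R + 1 :> R by rewrite -natr1.
rewrite !nS in up dn lo hi *; apply/andP; split; lra.
Qed.

Lemma sum_hyperbola (V : nmodType) (f : nat -> nat -> V) N :
  \sum_(1 <= d < N.+1) \sum_(1 <= n < (N %/ d).+1) f d n =
  \sum_(1 <= n < N.+1) \sum_(1 <= d < (N %/ n).+1) f d n.
Proof.
have aux (g : nat -> nat -> V) : \sum_(1 <= d < N.+1) \sum_(1 <= n < (N %/ d).+1) g d n
    = \sum_(1 <= d < N.+1) \sum_(1 <= n < N.+1) if (d * n <= N)%N then g d n else 0.
  apply: eq_big_nat => d /andP[d0 dN].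
  rewrite [RHS](@big_cat_nat _ _ _ (N %/ d).+1) //= ?ltnS ?leq_div //.
  rewrite [X in _ = _ + X]big_nat_cond [X in _ = _ + X]big1 ?addr0; last first.
    move=> n /andP[/andP[nd _] _]; rewrite ifF //; apply/negbTE; rewrite -ltnNge.
    by rewrite mulnC -ltn_divLR.
  apply: eq_big_nat => n /andP[_ nd]; rewrite ifT //.
  by rewrite mulnC -leq_divRL // -ltnS.
rewrite aux (aux (fun n d => f d n)) exchange_big_nat /=.
by apply: eq_bigr => n _; apply: eq_bigr => d _; rewrite mulnC.
Qed.

(** Chebyshev's function at integer arguments; [psi] extends it to the reals. *)
Definition psin N : R := \sum_(1 <= n < N.+1) vonmangoldt n.

Lemma psin_ge0 N : 0 <= psin N.
Proof. by apply: sumr_ge0 => n _; apply: vonmangoldt_ge0. Qed.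

(** Legendre's formula, by summing [sum_vonmangoldt] over all integers up to [N]. *)
Lemma lnfact_vonmangoldt N :
  lnfact N = \sum_(1 <= d < N.+1) vonmangoldt d * (N %/ d)%N%:R.
Proof.
transitivity (\sum_(1 <= d < N.+1) \sum_(1 <= n < (N %/ d).+1) (vonmangoldt d : R)).
  rewrite (exchange_sum_dvd (fun d _ => vonmangoldt d)).
  by apply: eq_big_nat => m /andP[m0 _]; rewrite sum_vonmangoldt.
by apply: eq_bigr => d _; rewrite sumr_const_nat subSS subn0 mulr_natr.
Qed.

Lemma lnfact_psin N : lnfact N = \sum_(1 <= n < N.+1) psin (N %/ n).
Proof.
rewrite lnfact_vonmangoldt -(sum_hyperbola (fun d _ => vonmangoldt d)).
by apply: eq_bigr => d _; rewrite sumr_const_nat subSS subn0 mulr_natr.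
Qed.

(** Chebyshev's device: on the right the weight of [vonmangoldt d] is never negative, and it is at
    least 1 when [d] exceeds [N %/ 2]. *)
Lemma psin_half N : psin N - psin (N %/ 2) <= lnfact N - 2 * lnfact (N %/ 2).
Proof.
have -> : lnfact (N %/ 2) = \sum_(1 <= d < N.+1) vonmangoldt d * (N %/ 2 %/ d)%N%:R.
  rewrite lnfact_vonmangoldt [RHS](@big_cat_nat _ _ _ (N %/ 2).+1) ?ltnS ?leq_div //=.
  rewrite [X in _ = _ + X]big_nat_cond [X in _ = _ + X]big1 ?addr0 // => d.
  by move=> /andP[/andP[Nd _] _]; rewrite divn_small ?mulr0.
rewrite lnfact_vonmangoldt mulr_sumr -sumrB /psin.
rewrite (@big_cat_nat _ _ _ (N %/ 2).+1) ?ltnS ?leq_div //=; rewrite [leLHS]addrC addKr.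
rewrite [leRHS](@big_cat_nat _ _ _ (N %/ 2).+1) ?ltnS ?leq_div //=.
have term d : vonmangoldt d * (N %/ d)%N%:R - 2 * (vonmangoldt d * (N %/ 2 %/ d)%N%:R)
   = vonmangoldt d * ((N %/ d)%N%:R - (2 * (N %/ 2 %/ d)%N%:R)) :> R by ring.
rewrite -[leLHS]add0r lerD //.
  apply: sumr_ge0 => d _; rewrite term mulr_ge0 ?vonmangoldt_ge0 // subr_ge0.
  rewrite -natrM ler_nat -divnMA mulnC [(2 * d)%N]mulnC divnMA.
  exact: leq_divM.
apply: ler_sum_nat => d /andP[Nd dN]; rewrite term ler_peMr ?vonmangoldt_ge0 //.
rewrite (divn_small Nd) mulr0 subr0 ler1n divn_gt0 //.
exact: leq_trans Nd.
Qed.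

(** Strong induction along [N %/ 2]. The terms in [N * ln N] of the two Stirling bounds cancel up to
    one logarithm, which leaves at most [4 * N], and the induction hypothesis contributes at most
    [5 * N]. *)
Lemma psin_le N : psin N <= 10 * N%:R.
Proof.
elim/ltn_ind: N => N IH; have [N1|N1] := leqP N 1.
  have -> : psin N = 0; last by rewrite mulr_ge0.
  case: N N1 {IH} => [|[|]] // _; first by rewrite /psin big_geq.
  by rewrite /psin big_nat1 vonmangoldt1.
set M := (N %/ 2)%N; have MN : (M < N)%N by rewrite ltn_Pdiv // ltnW.
have M0 : (0 < M)%N by rewrite divn_gt0.
have M0R : 0 < M%:R :> R by rewrite ltr0n.
have N1R : 1 <= N%:R :> R by rewrite ler1n ltnW.
have N3M : N%:R <= 3 * M%:R :> R by rewrite -natrM ler_nat /M; lia.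
have N2M : N%:R <= 2 * M%:R + 1 :> R by rewrite -natrM natr1 ler_nat /M; lia.
have M2N : 2 * M%:R <= N%:R :> R by rewrite -natrM ler_nat /M; lia.
have lnM : ln N%:R - 2 <= ln M%:R :> R.
  have : ln (N%:R : R) <= ln (3 * M%:R) by apply: ler_lnr => //; lra.
  rewrite lnM ?posrE //; have : ln (3 : R) <= 2 by apply: le_trans (ln_le_subr1 _) _ => //; lra.
  lra.
have lnN0 : 0 <= ln (N%:R : R) by apply: ln_ge0.
have lnN : ln (N%:R : R) <= N%:R - 1 by apply: ln_le_subr1; lra.
have := psin_half N; rewrite -/M.
have /andP[_ up] := @lnfact_bounds N (ltnW N1); have /andP[dn _] := lnfact_bounds M0.
have IHM := IH _ MN.
have : M%:R * (ln N%:R - 2) <= M%:R * ln M%:R :> R by rewrite ler_pM2l.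
have : (N%:R - 2 * M%:R) * ln N%:R <= ln N%:R :> R.
  by rewrite ler_piMl //; lra.
lra.
Qed.

End LogarithmicSums.

Section Selberg.
Context {R : realType}.
Implicit Types (N M : nat) (x y : R).
Local Notation Lambda := (@vonmangoldt R).
Local Notation psin := (@psin R).

(** [N] times the sum has weights [N / n] where Legendre's formula has their integer parts; the
    difference is at most [psin N], which Chebyshev's bound controls. *)
Lemma mertens N : (0 < N)%N ->
  ln (N%:R : R) - 1 <= \sum_(1 <= n < N.+1) Lambda n / n%:R <= ln N%:R + 11.
Proof.
move=> N0; have N0R : 0 < N%:R :> R by rewrite ltr0n.
have /andP[lo up] := @lnfact_bounds R N N0.
have psiN := @psin_le R N.
have lnN : ln (N%:R : R) <= N%:R - 1 by apply: ln_le_subr1.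
set S := \sum_(1 <= n < N.+1) _.
have fl n : (0 < n)%N -> (N %/ n)%N%:R <= (N%:R / n%:R : R) <= (N %/ n)%N%:R + 1.
  move=> n0; rewrite ler_pdivlMr ?ltr0n // ler_pdivrMr ?ltr0n // natr1 -!natrM !ler_nat.
  by rewrite leq_divM /= ltnW // ltn_ceil.
have SE : N%:R * S = \sum_(1 <= n < N.+1) Lambda n * (N%:R / n%:R).
  by rewrite mulr_sumr; apply: eq_bigr => n _; rewrite mulrCA mulrA.
have loS : lnfact N <= N%:R * S.
  rewrite SE lnfact_vonmangoldt; apply: ler_sum_nat => n /andP[n0 _].
  by rewrite ler_wpM2l ?vonmangoldt_ge0 //; have /andP[] := fl n n0.
have upS : N%:R * S <= lnfact N + psin N.
  rewrite SE lnfact_vonmangoldt -big_split; apply: ler_sum_nat => n /andP[n0 _] /=.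
  rewrite -[X in _ + X]mulr1 -mulrDr.
  by rewrite ler_wpM2l ?vonmangoldt_ge0 //; have /andP[] := fl n n0.
have N1R : 1 <= N%:R :> R by rewrite ler1n.
by apply/andP; split; rewrite -(ler_pM2l N0R); lra.
Qed.

Definition harmonic_sum N : R := \sum_(1 <= n < N.+1) n%:R^-1.

(** The witness [g] is Euler's constant: [u] increases, [v] decreases, and [u] stays below [v]. *)
Lemma harmonic_sum_ln : exists2 g : R, 0 <= g <= 1 &
  forall N, (0 < N)%N -> ln N%:R + g <= harmonic_sum N <= ln N.+1%:R + g.
Proof.
pose u N := harmonic_sum N - ln N.+1%:R; pose v N := harmonic_sum N - ln N%:R.
have harmS N : harmonic_sum N.+1 = harmonic_sum N + N.+1%:R^-1.
  by rewrite /harmonic_sum big_nat_recr.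
have uS N : u N <= u N.+1.
  by have := @lnS_sub_le R N.+1 isT; rewrite /u harmS; move: (_^-1) (ln _) (ln _) => *; lra.
have vS N : (0 < N)%N -> v N.+1 <= v N.
  by move=> N0; have := @lnS_sub_ge R N N0; rewrite /v harmS; move: (_^-1) (ln _) (ln _) => *; lra.
have u_homo : {homo u : m n / (m <= n)%N >-> m <= n}.
  by apply: homo_leq => //; apply: le_trans.
have v_homo n m : (0 < n)%N -> v (n + m)%N <= v n.
  move=> n0; elim: m => [|m IH]; rewrite ?addn0 // addnS.
  by apply: le_trans IH; apply: vS; rewrite addn_gt0 n0.
have uv N : (0 < N)%N -> u N <= v N.
  by move=> N0; rewrite /u /v lerD2l lerN2 ler_lnr ?ltr0n ?ler_nat.
have uvn m n : (0 < n)%N -> u m <= v n.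
  move=> n0; apply: (@le_trans _ _ (u (m + n)%N)); first by rewrite u_homo ?leq_addr.
  apply: (@le_trans _ _ (v (n + m)%N)); last exact: v_homo.
  by rewrite addnC uv // addn_gt0 n0.
pose g := sup (range u).
have ug N : u N <= g.
  by apply: ub_le_sup; [exists (v 1%N) => _ [m _ <-]; apply: uvn | exists N].
have gv N : (0 < N)%N -> g <= v N.
  move=> N0; apply: ge_sup; first by exists (u 0%N), 0%N.
  by move=> _ [m _ <-]; apply: uvn.
exists g.
  apply/andP; split.
    by apply: le_trans (ug 0%N); rewrite /u /harmonic_sum big_geq // ln1 subrr.
  by apply: le_trans (gv 1%N isT) _; rewrite /v /harmonic_sum big_nat1 ln1 subr0 invr1.
by move=> N N0; have := ug N; have := gv N N0; rewrite /u /v; lra.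
Qed.

Lemma sum_inv_sqrt_le N : \sum_(1 <= d < N.+1) (Num.sqrt (d%:R : R))^-1 <= 2 * Num.sqrt N%:R.
Proof.
elim: N => [|N IH]; first by rewrite big_geq // mulr_ge0 ?sqrtr_ge0.
rewrite big_nat_recr //=; apply: le_trans (lerD IH (lexx _)) _.
set s := Num.sqrt N%:R; set t := Num.sqrt N.+1%:R.
have s2 : s ^+ 2 = N%:R by rewrite sqr_sqrtr.
have t2 : t ^+ 2 = N%:R + 1 by rewrite sqr_sqrtr // natr1.
have s0 : 0 <= s := sqrtr_ge0 _.
have t0 : 0 < t by rewrite sqrtr_gt0.
rewrite -lerBrDl -mulrBr -[leLHS]mul1r ler_pdivrMr //.
by have := sqr_ge0 (t - s); nra.
Qed.

Lemma ln_le_sqrt x : 0 < x -> ln x <= 2 * Num.sqrt x.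
Proof.
move=> x0; rewrite -[in leLHS](sqr_sqrtr (ltW x0)) lnXn ?sqrtr_gt0 // -[leLHS]mulr_natl.
by rewrite ler_pM2l // (le_trans (ln_le_subr1 _)) ?sqrtr_gt0 // gerBl.
Qed.

(** [ln x] is at most four times the fourth root of [x], so its square contributes 16; the linear
    term contributes 6. *)
Lemma ln_mul_le_sqrt x : 1 <= x -> ln x * (3 + ln x) <= 22 * Num.sqrt x.
Proof.
move=> x1; have x0 : 0 < x by lra.
have := ln_le_sqrt x0; set s := Num.sqrt x => ls.
have s0 : 0 < s by rewrite sqrtr_gt0.
have := ln_le_sqrt s0; set r := Num.sqrt s => lr.
have r2 : r ^+ 2 = s by rewrite sqr_sqrtr // ltW.
have lx : ln x = 2 * ln s.
  by rewrite -[in LHS](sqr_sqrtr (ltW x0)) lnXn ?sqrtr_gt0 // [RHS]mulr_natl.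
have l0 : 0 <= ln x by apply: ln_ge0.
have : ln x ^+ 2 <= (4 * r) ^+ 2 by rewrite ler_sqr ?nnegrE // ?lx ?mulr_ge0 ?sqrtr_ge0 //; lra.
by rewrite exprMn r2; lra.
Qed.

(** Collect the terms with [d * n = m] and split [ln (N / d)] as [ln (m / d) + ln (N / m)]. The
    first part sums to [vonmangoldt m] by [sum_mobius_ln]; the second vanishes for [m > 1] by
    [sum_mobius]. *)
Lemma tatuzawa_iseki (F : nat -> R) N : (0 < N)%N ->
  \sum_(1 <= d < N.+1) mobius d * ln (N%:R / d%:R) *
    (\sum_(1 <= n < (N %/ d).+1) F (d * n)%N) =
  F 1%N * ln N%:R + \sum_(1 <= m < N.+1) Lambda m * F m.
Proof.
move=> N0; have N0R : 0 < N%:R :> R by rewrite ltr0n.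
under eq_bigr => d _ do rewrite mulr_sumr.
rewrite (exchange_sum_dvd (fun d m => mobius d * ln (N%:R / d%:R) * F m)).
transitivity (\sum_(1 <= m < N.+1) ((m == 1)%N%:R * ln (N%:R / m%:R) * F m + Lambda m * F m)).
  apply: eq_big_nat => m /andP[m0 mN]; have m0R : 0 < m%:R :> R by rewrite ltr0n.
  rewrite -mulr_suml -mulrDl; congr (_ * _).
  rewrite -sum_mobius_ln // -sum_mobius // mulr_suml -big_split /= big_nat_cond [RHS]big_nat_cond.
  apply: eq_bigr => d /andP[/andP[d0 _] _].
  rewrite -mulrDr !ln_div ?posrE ?ltr0n //; congr (_ * _); lra.
rewrite big_split /=; congr (_ + _).
rewrite big_ltn // big_nat_cond big1 ?addr0 => [|m /andP[/andP[m1 _] _]].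
  by rewrite eqxx mul1r divr1 mulrC.
by rewrite gtn_eqF // !mul0r.
Qed.

Lemma selberg N : (0 < N)%N ->
  `|psin N * ln N%:R + \sum_(1 <= m < N.+1) Lambda m * psin (N %/ m)
     - 2 * (N%:R * ln N%:R)| <= 80 * N%:R.
Proof.
move=> N0; have N1R : 1 <= N%:R :> R by rewrite ler1n.
have N0R : 0 < N%:R :> R by lra.
have [g /andP[g0 g1] harm] := harmonic_sum_ln.
(* With [y = N / d], the constant [1 + g] makes the terms in [y * ln y] and in [y] cancel in the
   inner sum, by the Stirling and harmonic bounds; at most [3 + ln y] remains. *)
pose F m : R := psin (N %/ m) - N%:R / m%:R + (1 + g).
have main : `|\sum_(1 <= d < N.+1) mobius d * ln (N%:R / d%:R) *
    (\sum_(1 <= n < (N %/ d).+1) F (d * n)%N)| <= 44 * N%:R.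
  apply: le_trans (ler_norm_sum _ _ _) _.
  apply: (@le_trans _ _ (\sum_(1 <= d < N.+1) 22 * (Num.sqrt N%:R * (Num.sqrt d%:R)^-1))).
    apply: ler_sum_nat => d /andP[d0 dN].
    have d0R : 0 < d%:R :> R by rewrite ltr0n.
    set y : R := N%:R / d%:R.
    have y1 : 1 <= y by rewrite ler_pdivlMr // mul1r ler_nat -ltnS.
    rewrite -sqrtrV ?ler0n // -sqrtrM ?ler0n // -/y.
    apply: le_trans (ln_mul_le_sqrt y1).
    rewrite !normrM (ger0_norm (ln_ge0 y1)).
    apply: ler_pM => //; first by rewrite mulr_ge0 ?ln_ge0.
      by rewrite ler_piMl ?ln_ge0 ?normr_mobius_le1.
    set M := (N %/ d)%N; have M0 : (0 < M)%N by rewrite divn_gt0 // -ltnS.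
    have M0R : 0 < M%:R :> R by rewrite ltr0n.
    have /andP[My yM] : M%:R <= y <= M%:R + 1.
      rewrite /y ler_pdivlMr // ler_pdivrMr // natr1 -!natrM !ler_nat.
      by rewrite leq_divM /= ltnW // ltn_ceil.
    have -> : \sum_(1 <= n < M.+1) F (d * n)%N =
        lnfact M - y * harmonic_sum M + (1 + g) * M%:R.
      rewrite lnfact_psin /harmonic_sum mulr_sumr /F big_split /= sumrB.
      rewrite sumr_const_nat subSS subn0 mulr_natr; congr (_ - _ + _).
        by apply: eq_bigr => n _; rewrite divnMA.
      by apply: eq_big_nat => n /andP[n0 _]; rewrite natrM invfM mulrA.
    have /andP[lo up] := @lnfact_bounds R M M0.
    have /andP[hlo hup] := harm M M0.
    have lM : ln (M%:R : R) <= ln y by apply: ler_lnr.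
    have lM0 : 0 <= ln (M%:R : R) by apply: ln_ge0; rewrite ler1n.
    have lS : M%:R * (ln M.+1%:R - ln M%:R) <= 1 :> R.
      by rewrite mulrC -ler_pdivlMr // mul1r lnS_sub_le.
    have lS1 : ln M.+1%:R - ln M%:R <= 1 :> R.
      by apply: (le_trans (lnS_sub_le M0)); rewrite invf_le1 // ler1n.
    set H := harmonic_sum M in hlo hup *.
    set e := H - ln M%:R - g.
    have e0 : 0 <= e by rewrite /e; lra.
    have e1 : e <= ln M.+1%:R - ln M%:R by rewrite /e; lra.
    have ye0 : 0 <= y * e by rewrite mulr_ge0 //; lra.
    have ye : y * e <= 2.
      have : y * e <= (M%:R + 1) * (ln M.+1%:R - ln M%:R).
        by apply: ler_pM => //; lra.
      lra.
    have HE : H = ln M%:R + g + e by rewrite /e; ring.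
    have yM0 : 0 <= (y - M%:R) * ln M%:R by rewrite mulr_ge0 //; lra.
    have yM1 : (y - M%:R) * ln M%:R <= ln M%:R by rewrite ler_piMl //; lra.
    have yg0 : 0 <= (y - M%:R) * g by rewrite mulr_ge0 //; lra.
    have yg1 : (y - M%:R) * g <= 1 by rewrite mulr_ile1 //; lra.
    rewrite HE ler_norml; apply/andP; split; lra.
  rewrite -mulr_sumr -mulr_sumr.
  have := sum_inv_sqrt_le N.
  rewrite -(@ler_pM2l _ (Num.sqrt N%:R)) ?sqrtr_gt0 // mulrCA -expr2 sqr_sqrtr ?ler0n //.
  lra.
rewrite tatuzawa_iseki // in main.
(* By Mertens the sum of [Lambda m / m] is [ln N] up to a bounded error; together with the part
   [- N * ln N] of [F 1 * ln N] it produces the main term [2 * N * ln N]. *)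
have FE : \sum_(1 <= m < N.+1) Lambda m * F m =
   \sum_(1 <= m < N.+1) Lambda m * psin (N %/ m)
   - N%:R * (\sum_(1 <= m < N.+1) Lambda m / m%:R) + (1 + g) * psin N.
  rewrite !mulr_sumr -sumrB -big_split /=; apply: eq_bigr => m _.
  by rewrite /F; ring.
rewrite FE /F divn1 divr1 in main.
have /andP[mlo mup] := mertens N0.
have psiN := @psin_le R N; have psi0 := @psin_ge0 R N.
set S := \sum_(1 <= m < N.+1) Lambda m / m%:R in main mlo mup *.
have {}mlo : N%:R * (ln N%:R - 1) <= N%:R * S by rewrite ler_pM2l.
have {}mup : N%:R * S <= N%:R * (ln N%:R + 11) by rewrite ler_pM2l.
have lnN : ln (N%:R : R) <= N%:R - 1 by apply: ln_le_subr1.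
have lnN0 : 0 <= ln (N%:R : R) by apply: ln_ge0.
have gp0 : 0 <= g * psin N by rewrite mulr_ge0.
have gp1 : g * psin N <= psin N by rewrite ler_piMl.
have gl0 : 0 <= g * ln N%:R by rewrite mulr_ge0.
have gl1 : g * ln N%:R <= ln N%:R by rewrite ler_piMl.
move: main; rewrite !ler_norml => /andP[m1 m2]; apply/andP; split; lra.
Qed.

End Selberg.

(** * Prime powers in short intervals *)

Section ShortIntervals.
Context {R : realType}.
Implicit Types (N M X Y m n : nat) (x y z u v : R).
Local Notation Lambda := (@vonmangoldt R).
Local Notation psin := (@psin R).
Local Notation lambda n := (Lambda n / n%:R).

Lemma lambda_ge0 n : 0 <= lambda n.
Proof. by rewrite divr_ge0 ?vonmangoldt_ge0. Qed.

Lemma psin_homo : {homo psin : m n / (m <= n)%N >-> m <= n}.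
Proof.
move=> m n mn; rewrite /psin [leRHS](@big_cat_nat _ _ _ m.+1) //=.
by rewrite lerDl sumr_ge0 // => i _; apply: vonmangoldt_ge0.
Qed.

Lemma truncn_divn x m : 0 <= x -> (0 < m)%N ->
  Num.truncn (x / m%:R) = (Num.truncn x %/ m)%N.
Proof.
move=> x0 m0; have m0R : 0 < m%:R :> R by rewrite ltr0n.
have /andP[tx xt] := truncn_itv x0.
apply: truncn_def; rewrite ler_pdivlMr // ltr_pdivrMr //; apply/andP; split.
  by apply: le_trans tx; rewrite -natrM ler_nat leq_divM.
apply: lt_le_trans xt _; rewrite -natrM ler_nat; exact: ltn_ceil.
Qed.

(** Selberg's formula at [Y] minus the one at [X]. As [Y <= 3 * X], replacing [ln Y] by [ln X]
    changes only terms of order [X]. *)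
Lemma selberg_diff X Y : (0 < X)%N -> (X <= Y)%N -> (Y <= 3 * X)%N ->
  `|(psin Y - psin X) * ln X%:R
    + \sum_(1 <= m < Y.+1) Lambda m * (psin (Y %/ m) - psin (X %/ m))
    - 2 * (Y%:R - X%:R) * ln X%:R| <= 20 ^+ 2 * X%:R.
Proof.
move=> X0 XY Y3X; have Y0 : (0 < Y)%N by apply: leq_trans XY.
have X0R : 0 < X%:R :> R by rewrite ltr0n.
have XYR : X%:R <= Y%:R :> R by rewrite ler_nat.
have Y3XR : Y%:R <= 3 * X%:R :> R by rewrite -natrM ler_nat.
have sX := @selberg R X X0; have sY := @selberg R Y Y0.
have -> : \sum_(1 <= m < Y.+1) Lambda m * (psin (Y %/ m) - psin (X %/ m)) =
    \sum_(1 <= m < Y.+1) Lambda m * psin (Y %/ m)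
    - \sum_(1 <= m < X.+1) Lambda m * psin (X %/ m).
  transitivity (\sum_(1 <= m < Y.+1) Lambda m * psin (Y %/ m)
    - \sum_(1 <= m < Y.+1) Lambda m * psin (X %/ m)).
    by rewrite -sumrB; apply: eq_bigr => m _; rewrite mulrBr.
  congr (_ - _); rewrite (@big_cat_nat _ _ _ X.+1) //=.
  rewrite [X in _ + X]big_nat_cond [X in _ + X]big1 ?addr0 // => m.
  move=> /andP[/andP[Xm _] _].
  by rewrite divn_small // /psin big_geq // mulr0.
set SX := \sum_(1 <= m < X.+1) _ in sX *; set SY := \sum_(1 <= m < Y.+1) _ in sY *.
set d := ln (Y%:R : R) - ln X%:R.
have d0 : 0 <= d by rewrite subr_ge0 ler_lnr.
have d2 : d <= 2.
  rewrite /d -ln_div ?posrE ?ltr0n // (le_trans (ln_le_subr1 _)) ?divr_gt0 ?ltr0n //.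
  by rewrite lerBlDr ler_pdivrMr //; lra.
have psiY := @psin_le R Y; have psiY0 := @psin_ge0 R Y.
have pd0 : 0 <= psin Y * d by rewrite mulr_ge0.
have pd1 : psin Y * d <= 10 * Y%:R * 2 by apply: ler_pM.
have Yd0 : 0 <= Y%:R * d by rewrite mulr_ge0.
have Yd1 : Y%:R * d <= Y%:R * 2 by rewrite ler_wpM2l.
have dE : ln (Y%:R : R) = ln X%:R + d by rewrite /d; ring.
rewrite dE in sY; clearbody d.
by move: sX sY; rewrite !ler_norml => /andP[? ?] /andP[? ?]; apply/andP; split; lra.
Qed.

Definition psi x : R := psin (Num.truncn x).

Lemma psi_ge0 x : 0 <= psi x. Proof. exact: psin_ge0. Qed.

Lemma psi_homo : {homo psi : x y / x <= y}.
Proof. by move=> x y xy; apply: psin_homo; apply: le_truncn. Qed.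

Lemma psi_le x : 0 <= x -> psi x <= 10 * x.
Proof.
move=> x0; apply: (le_trans (psin_le _)).
by rewrite ler_pM2l // truncn_le.
Qed.

Lemma psi_diff u v N : 0 <= u -> u <= v -> v <= N%:R ->
  psi v - psi u = \sum_(1 <= n < N.+1 | (u < n%:R) && (n%:R <= v)) Lambda n.
Proof.
move=> u0 uv vN; have v0 := le_trans u0 uv.
have aux w : 0 <= w -> w <= N%:R ->
    psi w = \sum_(1 <= n < N.+1 | n%:R <= w) Lambda n.
  move=> w0 wN; rewrite /psi /psin.
  have tN : (Num.truncn w <= N)%N by rewrite -(ler_nat R) (le_trans _ wN) ?truncn_le.
  rewrite [RHS](@big_cat_nat _ _ _ (Num.truncn w).+1) //=.
  rewrite [X in _ = _ + X]big_nat_cond [X in _ = _ + X]big1 ?addr0; last first.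
    move=> n /andP[/andP[wn _] nw]; move: wn.
    by rewrite truncn_lt_nat // ltNge nw.
  rewrite [RHS]big_mkcond; apply: eq_big_nat => n /andP[_].
  by rewrite ltnS truncn_ge_nat // => ->.
rewrite (aux v) // (aux u) ?(le_trans uv) // (bigID (fun n => n%:R <= u)) /=.
rewrite (eq_bigl (fun n => n%:R <= u)) => [|n]; last first.
  by apply: andb_idl => /le_trans; apply.
rewrite addrC addrK; apply: eq_bigl => n; by rewrite andbC -ltNge.
Qed.

Lemma ln_nat_unbounded (C : R) : exists X0, forall X, (X0 <= X)%N -> C <= ln X%:R.
Proof.
exists (Num.truncn (expR C)).+1 => X hX.
rewrite -[leLHS]expRK ler_lnr ?expR_gt0 //.
by rewrite (le_trans (ltW (truncnS_gt _))) ?ler_nat.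
Qed.

Definition psi_short_bound (e y0 : R) : Prop :=
  forall y z, y0 <= y -> y <= z -> z <= 2 * y -> psi z - psi y <= 2 * (z - y) + e * y.

(** The sum in [selberg_diff] is nonnegative. Dropping it and dividing by [ln X] leaves twice the
    length plus at most [e / 2 * X]; rounding the endpoints costs at most 2, absorbed because
    [4 <= e * y]. *)
Lemma psi_short (e : R) : 0 < e -> exists2 y0 : R, 1 <= y0 & psi_short_bound e y0.
Proof.
move=> e0; have [N hN] := ln_nat_unbounded (2 * 20 ^+ 2 / e).
pose y0 := Num.max 2 (Num.max (4 / e) N.+1%:R).
exists y0; first by rewrite /y0 le_max ler1n.
move=> y z; rewrite /y0 !ge_max => /andP[y2 /andP[y4 yN]] yz zy.
have y0' : 0 <= y by lra.
set X := Num.truncn y; set Y := Num.truncn z.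
have /andP[Xy yX] : X%:R <= y < X%:R + 1 by rewrite natr1 truncn_itv.
have /andP[Yz zY] : Y%:R <= z < Y%:R + 1 by rewrite natr1 truncn_itv //; lra.
have X2 : (2 <= X)%N by rewrite truncn_ge_nat.
have XY : (X <= Y)%N by apply: le_truncn.
have Y3X : (Y <= 3 * X)%N.
  have : Y%:R < (2 * X + 2)%N%:R :> R by rewrite natrD natrM; lra.
  by rewrite ltr_nat addn2 ltnS => /leq_trans; apply; rewrite mulSn -add1n leq_add2r ltnW.
have NX : (N <= X)%N.
  have : N.+1%:R < X.+1%:R :> R by rewrite -[X.+1]addn1 natrD; lra.
  by rewrite ltr_nat ltnS => /ltnW.
have lX := hN X NX.
have X0R : 0 < X%:R :> R by rewrite ltr0n ltnW.
have e8 : 0 < 2 * 20 ^+ 2 / e by rewrite divr_gt0 ?mulr_gt0 ?exprn_gt0.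
have := @selberg_diff X Y (ltnW X2) XY Y3X.
set D := \sum_(_ <= _ < _) _ => /ler_normlP[_ up].
have D0 : 0 <= D.
  apply: sumr_ge0 => m _; rewrite mulr_ge0 ?vonmangoldt_ge0 // subr_ge0.
  by apply: psin_homo; apply: leq_div2r.
rewrite -/(psi y) -/(psi z) in up *.
have lX0 : 0 < ln X%:R :> R by lra.
have : (psi z - psi y) * ln X%:R <= (2 * (Y%:R - X%:R) + e / 2 * X%:R) * ln X%:R.
  have : 20 ^+ 2 * X%:R <= e / 2 * X%:R * ln X%:R.
    rewrite [leRHS]mulrAC ler_pM2r // -ler_pdivrMl ?divr_gt0 //.
    by apply: le_trans lX; rewrite invf_div; lra.
  lra.
rewrite ler_pM2r // => /le_trans; apply.
have : 4 <= e * y by rewrite mulrC -ler_pdivrMr.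
have : e / 2 * X%:R <= e / 2 * y by rewrite ler_pM2l ?divr_gt0.
lra.
Qed.

(** A difference of two Mertens estimates, uniform in [u]. The lower cut [A] is taken near [u / 2]
    so that it lies below the window, at the price of [ln 4 <= 2]; for [u < 2] the estimate at [B]
    alone suffices. *)
Lemma mertens_window u (K : R) N : 0 < u -> 1 <= K ->
  \sum_(1 <= m < N.+1 | (u <= m%:R) && (m%:R <= K * u)) lambda m <= ln K + 14.
Proof.
move=> u0 K1; have lK : 0 <= ln K by apply: ln_ge0.
have Ku0 : 0 <= K * u by rewrite mulr_ge0 //; lra.
set B := Num.truncn (K * u).
have BK : B%:R <= K * u by rewrite truncn_le.
have [B0|B0] := posnP B.
  rewrite big_nat_cond big1; first by lra.
  move=> m /andP[/andP[m1 _] /andP[_ mK]].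
  by move: mK; rewrite -truncn_ge_nat // -/B B0 leqNgt m1.
have B0R : 0 < B%:R :> R by rewrite ltr0n.
have /andP[_ mB] := @mertens R B B0.
have le_B (P : pred nat) : (forall m, (0 < m)%N -> P m -> (m <= B)%N) ->
    \sum_(1 <= m < N.+1 | P m) lambda m <= \sum_(1 <= m < B.+1 | P m) lambda m.
  move=> PB; have [NB|BN] := leqP N B.
    rewrite [leRHS](@big_cat_nat _ _ _ N.+1) //= lerDl sumr_ge0 // => i _.
    exact: lambda_ge0.
  rewrite (@big_cat_nat _ _ _ B.+1) //=; last by rewrite ltnW.
  rewrite gerDl big_nat_cond big1 // => i /andP[/andP[Bi iN] Pi].
  by have := PB i (leq_ltn_trans (leq0n B) Bi) Pi; rewrite leqNgt Bi.
have inB m : (0 < m)%N -> (u <= m%:R) && (m%:R <= K * u) -> (m <= B)%N.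
  by move=> _ /andP[_]; rewrite -truncn_ge_nat.
apply: le_trans (le_B _ inB) _.
have [u2|u2] := leP 2 u.
  set A := Num.truncn (u / 2).
  have A0 : (0 < A)%N by rewrite truncn_gt0 ler_pdivlMr // mul1r.
  have A0R : 1 <= A%:R :> R by rewrite ler1n.
  have /andP[Au uA] : A%:R <= u / 2 < A%:R + 1 by rewrite natr1 truncn_itv //; lra.
  have AB : (A <= B)%N by rewrite truncn_ge_nat //; nra.
  have /andP[mA _] := @mertens R A A0.
  have : \sum_(1 <= m < B.+1 | (u <= m%:R) && (m%:R <= K * u)) lambda m <=
      \sum_(A.+1 <= m < B.+1) lambda m.
    rewrite (@big_cat_nat _ _ _ A.+1) //= -[leRHS]add0r lerD //.
      rewrite big_nat_cond big1 // => m /andP[/andP[_ mA'] /andP[um _]].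
      have : m%:R <= A%:R :> R by rewrite ler_nat.
      by lra.
    rewrite big_mkcond; apply: ler_sum => m _; case: ifP => // _; exact: lambda_ge0.
  move: mB; rewrite (@big_cat_nat _ _ _ A.+1) //=.
  have : ln (B%:R : R) <= ln (K * 4 * A%:R).
    by apply: ler_lnr => //; nra.
  have l4 : ln (4 : R) <= 2.
    have -> : 4 = 2 ^+ 2 :> R by ring.
    rewrite lnXn // mulr2n.
    have : ln (2 : R) <= 1 by apply: le_trans (ln_le_subr1 _) _ => //; lra.
    lra.
  have -> : ln (K * 4 * A%:R) = ln K + (ln 4 + ln A%:R).
    by rewrite -mulrA !lnM ?posrE ?mulr_gt0 //; lra.
  lra.
have : \sum_(1 <= m < B.+1 | (u <= m%:R) && (m%:R <= K * u)) lambda m <=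
      \sum_(1 <= m < B.+1) lambda m.
  by rewrite big_mkcond; apply: ler_sum => m _; case: ifP => // _; exact: lambda_ge0.
have : ln (B%:R : R) <= ln (K * 2) by apply: ler_lnr => //; nra.
have l2 : ln (2 : R) <= 1 by apply: le_trans (ln_le_subr1 _) _ => //; lra.
rewrite lnM ?posrE //; lra.
Qed.

End ShortIntervals.

(** * Indices whose interval falls short of the maximal mass *)

Section DeficientIndices.
Context {R : realType}.
Implicit Types (N M X Y m n : nat) (x y z u v : R).
Local Notation Lambda := (@vonmangoldt R).
Local Notation psin := (@psin R).
Local Notation psi := (@psi R).
Local Notation lambda n := (Lambda n / n%:R).

(* The cutoff y0 m <= X restricts to the m for which psi_short applies to the interval
   (X / m, (1 + c) X / m]; its mass is then at most about 2 c X / m. *)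
Definition deficient (c tau y0 : R) X m : bool :=
  (y0 * m%:R <= X%:R) &&
  (psi ((1 + c) * X%:R / m%:R) - psi (X%:R / m%:R) < (2 * c - tau) * X%:R / m%:R).

(** The first term of [selberg_diff] vanishes, so the sum over [m] must carry all of
    [2 * c * X * ln X]. By [psi_short_bound] and Mertens it can carry at most [e * X * ln X] more,
    up to terms of order [X], while every deficient [m] loses [Lambda m * tau * X / m]. *)
Lemma deficient_mass (c tau eta y0 : R) : 0 < c <= 1 -> 0 < tau -> 0 < eta <= 1 ->
  tau <= 1 -> 1 <= y0 ->
  psi_short_bound (eta * tau / 2) y0 ->
  exists X0, forall X, (X0 <= X)%N -> psi ((1 + c) * X%:R) = psi X%:R ->
  \sum_(1 <= m < X.+1 | deficient c tau y0 X m) lambda m <= eta * ln X%:R.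
Proof.
move=> /andP[c0 c1] t0 /andP[eta0 eta1] t1 y01 U.
set e := eta * tau / 2 in U.
have e0 : 0 < e by rewrite /e divr_gt0 ?mulr_gt0.
have e1 : e <= 1 / 2 by rewrite /e ler_pM2r ?invr_gt0 // mulr_ile1 // ltW.
have [X0 hX0] := ln_nat_unbounded ((20 ^+ 2 * (2 + y0)) / e).
exists (maxn 3 X0) => X; rewrite geq_max => /andP[X3 /hX0 lX] psiX.
set x : R := X%:R in lX psiX *.
have x3 : 3 <= x by rewrite /x ler_nat.
have x0 : 0 < x by lra.
have lx : ln x <= x - 1 by apply: ln_le_subr1.
have {}lX : 20 ^+ 2 * (2 + y0) <= e * ln x by rewrite [leRHS]mulrC -ler_pdivrMr.
have lx0 : 0 < ln x by apply: ln_gt0; lra.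
have cx0 : 0 <= (1 + c) * x by rewrite mulr_ge0 //; lra.
have cx : 0 < c * x by rewrite mulr_gt0.
have cx1 : c * x <= x by rewrite ger_pMl.
set Y := Num.truncn ((1 + c) * x).
have /andP[Yx xY] : Y%:R <= (1 + c) * x < Y%:R + 1 by rewrite natr1 truncn_itv.
have XY : (X <= Y)%N by rewrite truncn_ge_nat // -/x; lra.
have Y3X : (Y <= 3 * X)%N by rewrite -(ler_nat R) natrM -/x; lra.
have X0' : (0 < X)%N by apply: ltn_trans X3.
have psinXY : psin Y = psin X by move: psiX; rewrite /psi -/Y natrK.
have := @selberg_diff R X Y X0' XY Y3X.
rewrite psinXY subrr mul0r add0r -/x => /ler_normlP[+ _].
pose Delta m := psi ((1 + c) * x / m%:R) - psi (x / m%:R).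
have DeltaE m : (0 < m)%N -> psin (Y %/ m) - psin (X %/ m) = Delta m.
  move=> m0; rewrite /Delta /psi !truncn_divn //.
  by rewrite natrK.
rewrite (eq_big_nat _ _ (F2 := fun m => Lambda m * Delta m)); last first.
  by move=> m /andP[m0 _]; rewrite DeltaE.
have psiY := @psin_le R Y.
(* For [y0 * m > x] the interval lies below [2 * y0], where Chebyshev's bound suffices: these [m]
   contribute only a term of order [x]. *)
rewrite (bigID (fun m => y0 * m%:R <= x)) /=.
set DP := \sum_(_ <= _ < _ | _) _; set DN := \sum_(_ <= _ < _ | _) _ => lo.
have DN_le : DN <= 20 * y0 * (20 * x).
  clear lo.
  apply: (@le_trans _ _ (\sum_(1 <= m < Y.+1) Lambda m * (20 * y0))).
    rewrite /DN big_mkcond; apply: ler_sum_nat => m /andP[m0 _].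
    have y200 : 0 <= 20 * y0 by lra.
    case: ifPn => [|_]; last by rewrite mulr_ge0 ?vonmangoldt_ge0.
    rewrite -ltNge => xm; rewrite ler_wpM2l ?vonmangoldt_ge0 //.
    have m0R : 0 < m%:R :> R by rewrite ltr0n.
    have : psi ((1 + c) * x / m%:R) <= 10 * (2 * y0).
      apply: (@le_trans _ _ (psi (2 * y0))); last by apply: psi_le; lra.
      apply: psi_homo; rewrite ler_pdivrMr //.
      have : (1 + c) * x <= 2 * x by rewrite ler_pM2r //; lra.
      lra.
    by have := @psi_ge0 R (x / m%:R); rewrite /Delta; lra.
  rewrite -mulr_suml mulrC ler_pM2l; last by lra.
  by rewrite -/(psin Y); lra.
have DP_eq : DP = \sum_(1 <= m < X.+1 | y0 * m%:R <= x) Lambda m * Delta m.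
  rewrite /DP (@big_cat_nat _ _ _ X.+1) //= [X in _ + X]big_nat_cond.
  rewrite [X in _ + X]big1 ?addr0 // => m /andP[/andP[Xm _] ym].
  have : x < m%:R by rewrite ltr_nat.
  have : m%:R <= y0 * m%:R by rewrite ler_peMl.
  lra.
have /andP[_ mX] := @mertens R X X0'; rewrite -/x in mX.
have cap : \sum_(1 <= m < X.+1 | y0 * m%:R <= x) Lambda m * ((2 * c + e) * x / m%:R)
    <= (2 * c + e) * x * (ln x + 11).
  clear lo DN_le DP_eq.
  have c0' : 0 <= (2 * c + e) * x by rewrite mulr_ge0 //; lra.
  apply: le_trans (ler_wpM2l c0' mX); rewrite mulr_sumr big_mkcond.
  apply: ler_sum => m _; case: ifP => _; first by rewrite mulrCA.
  by rewrite mulr_ge0 ?lambda_ge0.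
have : tau * x * (\sum_(1 <= m < X.+1 | deficient c tau y0 X m) lambda m) <=
  \sum_(1 <= m < X.+1 | y0 * m%:R <= x) Lambda m * ((2 * c + e) * x / m%:R)
  - \sum_(1 <= m < X.+1 | y0 * m%:R <= x) Lambda m * Delta m.
  clear lo DN_le DP_eq cap mX DP DN.
  rewrite -sumrB mulr_sumr big_mkcond [leRHS]big_mkcond /=.
  apply: ler_sum_nat => m /andP[m0 _]; rewrite /deficient -/x -/(Delta m).
  have m0R : 0 < m%:R :> R by rewrite ltr0n.
  have xm0 : 0 < x / m%:R by rewrite divr_gt0.
  have [ym|ym] := boolP (y0 * m%:R <= x) => //=; rewrite -mulrBr.
  have mx : y0 <= x / m%:R by rewrite ler_pdivlMr.
  have zE k : k * x / m%:R = k * (x / m%:R) by rewrite mulrA.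
  have := U (x / m%:R) ((1 + c) * x / m%:R) mx; rewrite -/(Delta m) !zE.
  set t := x / m%:R in xm0 mx *.
  have ct : 0 < c * t by rewrite mulr_gt0.
  have ct1 : c * t <= t by rewrite ger_pMl.
  have et : 0 < e * t by rewrite mulr_gt0.
  move=> Um; have {Um} : Delta m <= 2 * ((1 + c) * t - t) + e * t by apply: Um; lra.
  move=> Um; case: ifPn => dm; last by rewrite mulr_ge0 ?vonmangoldt_ge0 //; lra.
  have -> : tau * x * lambda m = Lambda m * (tau * t).
    by rewrite /t; ring.
  by rewrite ler_wpM2l ?vonmangoldt_ge0 //; lra.
rewrite -DP_eq => H.
rewrite -(@ler_pM2l _ (tau * x)) ?mulr_gt0 //; apply: le_trans H _.
(* One half pays for the excess [e] in the cap, the other for all terms of order [x], by the choice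
   of [X0]. *)
have -> : tau * x * (eta * ln x) = 2 * e * x * ln x by rewrite /e; field.
have : x * (20 ^+ 2 * (2 + y0)) <= x * (e * ln x) by rewrite ler_pM2l.
have : (Y%:R - x) * ln x >= (c * x - 1) * ln x by rewrite ler_pM2r //; lra.
have : (2 * c + e) * x <= 3 * x by rewrite ler_pM2r //; lra.
lra.
Qed.

End DeficientIndices.

(** * Centres around which deficient indices are rare *)

Section SparseCenter.
Context {R : realType}.
Implicit Types (N M X Y m n : nat) (x y z u v : R).
Local Notation Lambda := (@vonmangoldt R).
Local Notation psin := (@psin R).
Local Notation psi := (@psi R).
Local Notation lambda n := (Lambda n / n%:R).

Lemma swap_windows (B : pred nat) (W : nat -> nat -> bool) (C : R) X :
  (forall n, (0 < n)%N -> \sum_(1 <= m < X.+1 | W m n) lambda m <= C) ->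
  \sum_(1 <= m < X.+1) lambda m * (\sum_(1 <= n < X.+1 | B n && W m n) lambda n)
    <= C * \sum_(1 <= n < X.+1 | B n) lambda n.
Proof.
move=> WC.
under eq_bigr => m _ do rewrite mulr_sumr big_mkcond.
rewrite exchange_big_nat /= mulr_sumr [leRHS]big_mkcond.
apply: ler_sum_nat => n /andP[n0 _]; case: (B n) => /=; last by rewrite big1.
rewrite -big_mkcond -mulr_suml ler_wpM2r ?lambda_ge0 //; exact: WC.
Qed.

(** The sums measure [B] on the window from [m0 / K] to [m0] and on its image under [n |-> X / n].
    Both conditions place [m0] in a window starting at [n] or [X / n], the form required by
    [swap_windows] and [mertens_window]. *)
Definition sparse_center (B : pred nat) (K eta' : R) X m0 : Prop := [/\ ~~ B m0,
    \sum_(1 <= n < X.+1 | B n && ((n%:R <= m0%:R :> R) && (m0%:R <= K * n%:R))) lambda n < eta' &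
    \sum_(1 <= n < X.+1 | B n && ((X%:R / n%:R <= m0%:R :> R) && (m0%:R <= K * (X%:R / n%:R))))
      lambda n < eta'].

(* Averaging over m0 with weight lambda m0: each n lies in the windows of a set of m0 of bounded
   mass, so the deficient n cannot fill the windows of all m0. *)
Lemma exists_sparse_center (K y0 eta' : R) : 1 <= K -> 1 <= y0 -> 0 < eta' ->
  exists X0, forall X (B : pred nat), (X0 <= X)%N ->
  \sum_(1 <= m < X.+1 | B m) lambda m <=
     eta' / (2 * (eta' + 2 * (ln K + 14))) * ln X%:R ->
  exists m0, [/\ K * y0 <= m0%:R, y0 * m0%:R <= X%:R & sparse_center B K eta' X m0].
Proof.
move=> K1 y01 e0.
have lK : 0 <= ln K by apply: ln_ge0.
have ly : 0 <= ln y0 by apply: ln_ge0.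
(* By Mertens the admissible [m] have mass at least [ln X - (2 * ln y0 + ln K + 29)]. The threshold
   puts this above [ln X / 2], whereas failure at all of them would bound it by [ln X / 2]. *)
have [X0 hX0] := ln_nat_unbounded (2 * (2 * ln y0 + ln K + 29) + 1).
exists X0.+1 => X B XX0 Bmass; have {}lX := hX0 X (ltnW XX0).
have X0' : (0 < X)%N by apply: leq_ltn_trans XX0.
have XR : 0 < X%:R :> R by rewrite ltr0n.
pose b1 m := \sum_(1 <= n < X.+1 | B n && ((n%:R <= m%:R :> R) && (m%:R <= K * n%:R))) lambda n.
pose b2 m := \sum_(1 <= n < X.+1 |
  B n && ((X%:R / n%:R <= m%:R :> R) && (m%:R <= K * (X%:R / n%:R)))) lambda n.
apply: contrapT => nex.
have b1_ge0 m : 0 <= b1 m by apply: sumr_ge0 => n _; apply: lambda_ge0.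
have b2_ge0 m : 0 <= b2 m by apply: sumr_ge0 => n _; apply: lambda_ge0.
pose V m := (K * y0 <= m%:R) && (y0 * m%:R <= X%:R).
have all_bad m : V m -> eta' <= eta' * (B m)%:R + b1 m + b2 m.
  move=> /andP[Vm mV]; rewrite leNgt; apply/negP => lt.
  have := b1_ge0 m; have := b2_ge0 m; move: lt.
  case: (boolP (B m)) => Bm /=; rewrite ?mulr1 ?mulr0; first by lra.
  move=> lt b20 b10; apply: nex; exists m; split=> //; split=> //.
    by change (b1 m < eta'); lra.
  by change (b2 m < eta'); lra.
have V_le : eta' * \sum_(1 <= m < X.+1 | V m) lambda m <=
    eta' * \sum_(1 <= m < X.+1 | B m) lambda m
    + \sum_(1 <= m < X.+1) lambda m * b1 m + \sum_(1 <= m < X.+1) lambda m * b2 m.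
  rewrite !mulr_sumr [leLHS]big_mkcond.
  rewrite [X in X + _ + _]big_mkcond -!big_split /=; apply: ler_sum_nat => m _.
  have l0 := @lambda_ge0 R m.
  have := b1_ge0 m; have := b2_ge0 m => b20 b10.
  have p1 : 0 <= lambda m * b1 m by rewrite mulr_ge0.
  have p2 : 0 <= lambda m * b2 m by rewrite mulr_ge0.
  case: ifPn => [/all_bad Vm|_].
    have : lambda m * eta' <= lambda m * (eta' * (B m)%:R + b1 m + b2 m) by rewrite ler_wpM2l.
    by case: (B m) {Vm} => /=; lra.
  case: ifPn => _; last lra.
  have : 0 <= eta' * lambda m by rewrite mulr_ge0 // ltW.
  lra.
have b1_le : \sum_(1 <= m < X.+1) lambda m * b1 m <=
    (ln K + 14) * \sum_(1 <= n < X.+1 | B n) lambda n.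
  apply: swap_windows => n n0; apply: mertens_window => //; by rewrite ltr0n.
have b2_le : \sum_(1 <= m < X.+1) lambda m * b2 m <=
    (ln K + 14) * \sum_(1 <= n < X.+1 | B n) lambda n.
  apply: swap_windows => n n0; apply: mertens_window => //.
  by rewrite divr_gt0 // ltr0n.
have /andP[mX _] := @mertens R X X0'.
have low : \sum_(1 <= m < X.+1 | ~~ (K * y0 <= m%:R)) lambda m <= ln K + ln y0 + 14.
  rewrite -lnM ?posrE ?(lt_le_trans _ K1) ?(lt_le_trans _ y01) //.
  apply: le_trans (_ : _ <= \sum_(1 <= m < X.+1 |
      (1 <= m%:R :> R) && (m%:R <= K * y0 * 1)) lambda m) _.
    rewrite big_mkcond [leRHS]big_mkcond; apply: ler_sum_nat => m /andP[m0 _].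
    case: ifPn => [|_]; last by case: ifP => // _; apply: lambda_ge0.
    by rewrite -ltNge mulr1 ler1n m0 => /ltW ->.
  by apply: mertens_window => //; nra.
have high : \sum_(1 <= m < X.+1 | ~~ (y0 * m%:R <= X%:R)) lambda m <= ln y0 + 14.
  apply: le_trans (_ : _ <= \sum_(1 <= m < X.+1 |
      (X%:R / y0 <= m%:R) && (m%:R <= y0 * (X%:R / y0))) lambda m) _.
    rewrite big_mkcond [leRHS]big_mkcond; apply: ler_sum_nat => m /andP[m0 mX'].
    case: ifPn => [|_]; last by case: ifP => // _; apply: lambda_ge0.
    rewrite -ltNge => Xm; rewrite mulrCA divff ?mulr1; last by rewrite gt_eqF; lra.
    rewrite ler_nat -ltnS mX' andbT.
    have : X%:R / y0 <= m%:R; [rewrite ler_pdivrMr; lra|by move=> ->].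
  by apply: mertens_window => //; rewrite divr_gt0 //; lra.
have V_ge : ln X%:R - 1 - (ln K + ln y0 + 14) - (ln y0 + 14) <=
    \sum_(1 <= m < X.+1 | V m) lambda m.
  have : \sum_(1 <= m < X.+1) lambda m <= \sum_(1 <= m < X.+1 | V m) lambda m
    + \sum_(1 <= m < X.+1 | ~~ (K * y0 <= m%:R)) lambda m
    + \sum_(1 <= m < X.+1 | ~~ (y0 * m%:R <= X%:R)) lambda m.
    rewrite [X in _ <= X + _ + _]big_mkcond [X in _ <= _ + X + _]big_mkcond.
    rewrite [X in _ <= _ + _ + X]big_mkcond -!big_split /=.
    apply: ler_sum_nat => m _; rewrite /V; have := @lambda_ge0 R m.
    by clear; case: (K * y0 <= m%:R); case: (y0 * m%:R <= X%:R) => /=; lra.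
  lra.
set bm := \sum_(1 <= n < X.+1 | B n) lambda n in Bmass V_le b1_le b2_le.
set c := eta' + 2 * (ln K + 14) in Bmass.
have c0 : 0 < c by rewrite /c; lra.
have : c * bm <= eta' / 2 * ln X%:R.
  have -> : eta' / 2 * ln X%:R = c * (eta' / (2 * c) * ln X%:R).
    by field; rewrite gt_eqF.
  by rewrite ler_pM2l.
have : eta' * (ln X%:R - 1 - (ln K + ln y0 + 14) - (ln y0 + 14)) <=
   eta' * \sum_(1 <= m < X.+1 | V m) lambda m by rewrite ler_pM2l.
have : eta' * (2 * (2 * ln y0 + ln K + 29) + 1) <= eta' * ln X%:R by rewrite ler_pM2l.
by rewrite /c; lra.
Qed.

End SparseCenter.

(** * Descent along non-deficient indices *)

Section PrimePowerInShortInterval.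
Context {R : realType}.
Implicit Types (N M X Y m n : nat) (x y z u v : R).
Local Notation Lambda := (@vonmangoldt R).
Local Notation psin := (@psin R).
Local Notation psi := (@psi R).
Local Notation lambda n := (Lambda n / n%:R).

(** With [t = X / m], the whole interval misses twice its length by at most [tau * t], and the
    pieces left of [u] and right of [v] exceed twice theirs by at most [e * t] and [e * v]. Here
    [v <= 2 * t] and [e <= tau / 3]. *)
Lemma full_subinterval (c tau e y0 : R) X m u v : 0 < c <= 1 -> e <= tau / 3 -> 0 < e ->
  psi_short_bound e y0 ->
  (0 < m)%N -> 1 <= y0 -> y0 * m%:R <= X%:R -> ~~ deficient c tau y0 X m ->
  X%:R / m%:R <= u -> u <= v -> v <= (1 + c) * (X%:R / m%:R) ->
  2 * (v - u) - 2 * tau * (X%:R / m%:R) <= psi v - psi u.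
Proof.
move=> /andP[c0 c1] et e0 U m0 y01 ym; rewrite /deficient ym /= -leNgt.
rewrite -!mulrA; set t := X%:R / m%:R => full tu uv vt.
have m0R : 0 < m%:R :> R by rewrite ltr0n.
have yt : y0 <= t by rewrite ler_pdivlMr.
have t0 : 0 < t by lra.
have ct : 0 < c * t by rewrite mulr_gt0.
have ct1 : c * t <= t by rewrite ger_pMl.
have ett : e * t <= tau / 3 * t by rewrite ler_pM2r.
have ev : e * v <= e * (2 * t) by rewrite ler_pM2l //; lra.
have U1 := U t u yt tu (ltac:(lra)).
have U2 := U v ((1 + c) * t) (ltac:(lra)) vt (ltac:(lra)).
lra.
Qed.

(** Otherwise all the mass of [psi] between [u] and [v] sits on deficient [n <= v], and is at most
    [v] times their [lambda] mass. *)
Lemma exists_not_deficient (c tau y0 eta' : R) X u v : 0 <= u -> u <= v -> 0 < v ->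
  v <= X%:R -> eta' * v <= psi v - psi u ->
  \sum_(1 <= n < X.+1 | deficient c tau y0 X n && ((u < n%:R) && (n%:R <= v))) lambda n
    < eta' ->
  exists n, [/\ u < n%:R, n%:R <= v & ~~ deficient c tau y0 X n].
Proof.
move=> u0 uv v0 vX; rewrite (psi_diff u0 uv vX) => lo up; apply: contrapT => nex.
have : \sum_(1 <= n < X.+1 | (u < n%:R) && (n%:R <= v)) Lambda n <=
  v * \sum_(1 <= n < X.+1 | deficient c tau y0 X n && ((u < n%:R) && (n%:R <= v))) lambda n.
  rewrite mulr_sumr big_mkcond [leRHS]big_mkcond; apply: ler_sum_nat => n /andP[n0 _].
  case: ifPn => [/andP[un nv]|_]; last first.
    by case: ifP => // _; rewrite mulr_ge0 ?lambda_ge0 // ltW.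
  rewrite ifT; last by rewrite andbT; apply/negPn/negP => nd; apply: nex; exists n; split.
  rewrite mulrCA ler_peMr ?vonmangoldt_ge0 // ler_pdivlMr ?mul1r // ltr0n //.
have : v * \sum_(1 <= n < X.+1 | deficient c tau y0 X n && ((u < n%:R) && (n%:R <= v)))
   lambda n < v * eta' by rewrite ltr_pM2l.
lra.
Qed.

(* The two applications of m |-> X / m: m1 lies in the upper half of (X / m, (1 + c) X / m] and m2
   near the left end of (X / m1, (1 + c) X / m1], an interval which contains (m2, m]. *)
Lemma descent_step (c e y0 : R) X N m0 m :
  0 < c <= 1 / 10 -> 0 < e <= c / 64 / 3 -> 1 <= y0 -> psi_short_bound e y0 ->
  (1 + c) ^+ N.+1 * y0 <= m0%:R -> y0 * m0%:R <= X%:R ->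
  sparse_center (deficient c (c / 64) y0 X) ((1 + c) ^+ N.+1) (c / 8) X m0 ->
  (0 < m)%N -> ~~ deficient c (c / 64) y0 X m -> (m <= m0)%N -> m0%:R <= (1 + c) ^+ N * m%:R ->
  exists m2, [/\ (0 < m2)%N, ~~ deficient c (c / 64) y0 X m2, m2%:R <= (1 - c / 8) * m%:R,
    m%:R <= (1 + c) * m2%:R & 7 / 4 * (m%:R - m2%:R) <= psin m - psin m2].
Proof.
set B := deficient c (c / 64) y0 X; set K := (1 + c) ^+ N.+1.
move=> /andP[c0 c1] /andP[e0 e1] y0_ge1 psi_bound m0_ge m0_le [_ sparse_low sparse_high].
move=> m_gt0 Bm mm0 m0m.
(* [hit_high] yields indices near [X / m] and [hit_low] indices below [m0]; each uses one of the two
   sparse windows. *)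
have hit_high u v : 0 <= u -> u <= v -> 0 < v -> v <= X%:R ->
    c / 8 * v <= psi v - psi u -> X%:R <= u * m0%:R -> v * m0%:R <= K * X%:R ->
    exists n, [/\ u < n%:R, n%:R <= v & ~~ B n].
  move=> u0 uv v0 vX uv_psi Xu vK; apply: exists_not_deficient uv_psi _ => //.
  apply: le_lt_trans sparse_high; rewrite big_mkcond [leRHS]big_mkcond -/B.
  apply: ler_sum_nat => n /andP[n0 _]; have nR : 0 < n%:R :> R by rewrite ltr0n.
  case: (B n) => //=; case: ifPn => [/andP[un nv]|_].
    rewrite ifT // ler_pdivrMr // mulrA ler_pdivlMr //; apply/andP; split.
      by rewrite (le_trans Xu) // mulrC ler_wpM2l // ltW.
    by rewrite mulrC (le_trans _ vK) // ler_wpM2r.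
  by case: ifP => // _; apply: lambda_ge0.
have hit_low u v : 0 <= u -> u <= v -> 0 < v -> v <= X%:R ->
    c / 8 * v <= psi v - psi u -> v <= m0%:R -> m0%:R <= K * u ->
    exists n, [/\ u < n%:R, n%:R <= v & ~~ B n].
  move=> u0 uv v0 vX uv_psi vm0 m0u; apply: exists_not_deficient uv_psi _ => //.
  have K_ge0 : 0 <= K by rewrite exprn_ge0 // addr_ge0 // ltW.
  apply: le_lt_trans sparse_low; rewrite big_mkcond [leRHS]big_mkcond -/B.
  apply: ler_sum_nat => n /andP[n0 _].
  case: (B n) => //=; case: ifPn => [/andP[un nv]|_].
    by rewrite ifT // (le_trans nv vm0) (le_trans m0u) // ler_wpM2l // ltW.
  by case: ifP => // _; apply: lambda_ge0.
clear sparse_low sparse_high.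
have c_range1 : 0 < c <= 1 by rewrite c0; lra.
set P : R := (1 + c) ^+ N in m0m *; have KE : K = (1 + c) * P by rewrite /K exprS.
have P0 : 0 < P by rewrite exprn_gt0 //; lra.
have K0 : 0 < K by rewrite KE mulr_gt0 //; lra.
have mR : 0 < m%:R :> R by rewrite ltr0n.
have mm0R : m%:R <= m0%:R :> R by rewrite ler_nat.
have m0R : 0 < m0%:R :> R by lra.
have y00 : 0 < y0 by exact: lt_le_trans y0_ge1.
have ym : y0 * m%:R <= X%:R by rewrite (le_trans _ m0_le) // ler_wpM2l // ltW.
set x : R := X%:R; set t := x / m%:R.
have y0m : (1 + c) * y0 <= m%:R.
  rewrite -(@ler_pM2l _ P) // (le_trans _ m0m) // (le_trans _ m0_ge) // KE.
  by rewrite mulrA (mulrC P).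
have x0 : 0 < x by rewrite (lt_le_trans _ ym) // mulr_gt0 //; lra.
have tE : t * m%:R = x by rewrite /t divfK // gt_eqF.
have t0 : 0 < t by rewrite divr_gt0.
have yt : y0 <= t by rewrite ler_pdivlMr.
have ct : 0 < c * t by rewrite mulr_gt0.
have ct1 : c * t <= t / 10 by have := ler_wpM2r (ltW t0) c1; lra.
have cct : 0 <= c * (c * t) <= c * t / 10.
  have := ler_wpM2r (ltW ct) c1; rewrite mulr_ge0 ?(ltW ct) ?(ltW c0) //=; lra.
have vx : (1 + c) * t * y0 <= x.
  by rewrite -tE mulrAC (mulrC t) ler_pM2r.
have full1 := @full_subinterval c (c / 64) e y0 X m _ _ c_range1 e1 e0 psi_bound m_gt0
  y0_ge1 ym Bm.
rewrite -/x -/t in full1; clearbody t.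
(* Going beyond [(1 + c / 2) * t] forces [X / m1] below [m / (1 + c / 2)], which leaves room for
   [m2] well below [m]; staying within [(1 + c) * t] keeps [m] in the interval of [m1]. *)
have [m1 [um1 m1v Bm1]] : exists n, [/\ (1 + c / 2) * t < n%:R, n%:R <= (1 + c) * t & ~~ B n].
  apply: hit_high; try by clear -t0 ct; lra.
  - by rewrite (le_trans _ vx) // ler_peMr //; clear -t0 ct; lra.
  - apply: le_trans (full1 _ _ _ _ _); clear -t0 ct ct1 cct; lra.
  - by rewrite -/x -tE; apply: ler_pM => //; clear -t0 ct mR; lra.
  - apply: le_trans (ler_wpM2l _ m0m) _; first by clear -t0 ct; lra.
    by rewrite -/x -tE KE le_eqVlt; apply/orP; left; apply/eqP; ring.
have m1R : 0 < m1%:R :> R by clear -um1 t0 ct; lra.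
have m1_gt0 : (0 < m1)%N by rewrite -(ltr0n R).
have ym1 : y0 * m1%:R <= X%:R.
  by rewrite mulrC (le_trans _ vx) // ler_pM2r.
set t1 := x / m1%:R.
have t10 : 0 < t1 by rewrite divr_gt0.
have t1E : t1 * m1%:R = x by rewrite /t1 divfK // gt_eqF.
have t1m : (1 + c / 2) * t1 <= m%:R.
  by rewrite -(@ler_pM2l _ t) // tE -t1E mulrCA mulrA [leRHS]mulrC ler_pM2r // ltW.
have mt1 : m%:R <= (1 + c) * t1.
  by rewrite -(@ler_pM2l _ t) // tE -t1E [leRHS]mulrCA mulrA [leLHS]mulrC ler_pM2r.
have ct0 : 0 < c * t1 by rewrite mulr_gt0.
have ct11 : c * t1 <= t1 / 10 by have := ler_wpM2r (ltW t10) c1; clear; lra.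
have full2 := @full_subinterval c (c / 64) e y0 X m1 _ _ c_range1 e1 e0 psi_bound m1_gt0
  y0_ge1 ym1 Bm1.
rewrite -/x -/t1 in full2; clearbody t1.
have cct1 : 0 <= c * (c * t1) <= c * t1 / 10.
  have := ler_wpM2r (ltW ct0) c1; rewrite mulr_ge0 ?(ltW ct0) ?(ltW c0) //=; clear; lra.
have [m2 [um2 m2v Bm2]] : exists n, [/\ t1 < n%:R, n%:R <= (1 + c / 8) * t1 & ~~ B n].
  have t1m0 : (1 + c / 8) * t1 <= m0%:R by clear -t1m mm0R ct0; lra.
  apply: hit_low => //; try by clear -t10 ct0; lra.
  - by apply: le_trans m0_le; rewrite (le_trans t1m0) // ler_peMl // ltW.
  - apply: le_trans (full2 _ _ _ _ _); clear -t10 ct0 ct11 cct1; lra.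
  rewrite (le_trans m0m) // KE -mulrA mulrCA ler_pM2l //.
exists m2; clear -um2 m2v Bm2 t1m mt1 c0 c1 mR t10 ct0 ct11 cct1 full2.
(* This uses [1 + c / 8 <= (1 - c / 8) * (1 + c / 2)]. *)
have m2m : m2%:R <= (1 - c / 8) * m%:R.
  apply: le_trans m2v _.
  have : (1 - c / 8) * ((1 + c / 2) * t1) <= (1 - c / 8) * m%:R by rewrite ler_pM2l //; lra.
  lra.
split=> //.
- by rewrite -(ltr0n R); lra.
- by apply: le_trans mt1 _; rewrite ler_pM2l //; lra.
(* The loss [2 * (c / 64) * t1] is at most a quarter of [m - m2], because [t1 <= m] and
   [m - m2 >= c / 8 * m]; hence the density 7/4. *)
have := full2 m2%:R m%:R; rewrite /psi !natrK => /(_ (ltW um2)).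
have t1m' : t1 <= m%:R by clear -t1m ct0; lra.
have cm : c * t1 <= c * m%:R by rewrite ler_pM2l.
have cm0 : 0 < c * m%:R by rewrite mulr_gt0.
have m2m' : m2%:R <= m%:R :> R by clear -m2m cm0; lra.
by move=> /(_ m2m' mt1); clear -m2m cm; lra.
Qed.

(** Iterates [descent_step] from [m0]. A step divides [m] by at most [1 + c], so [N] steps stay in
    the windows of [m0], and it lowers [ln m] by at least [c / 8]. *)
Lemma descent (c e y0 : R) X N m0 j :
  0 < c <= 1 / 10 -> 0 < e <= c / 64 / 3 -> 1 <= y0 -> psi_short_bound e y0 ->
  (1 + c) ^+ N.+1 * y0 <= m0%:R -> y0 * m0%:R <= X%:R ->
  sparse_center (deficient c (c / 64) y0 X) ((1 + c) ^+ N.+1) (c / 8) X m0 ->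
  (0 < m0)%N -> (j <= N)%N ->
  exists m, [/\ (0 < m)%N, ~~ deficient c (c / 64) y0 X m, (m <= m0)%N,
    m0%:R <= (1 + c) ^+ j * m%:R &
    j%:R * (c / 8) <= ln (m0%:R : R) - ln m%:R /\
    3 / 2 * (ln m0%:R - ln m%:R) <=
      \sum_(1 <= n < m0.+1) lambda n - \sum_(1 <= n < m.+1) lambda n].
Proof.
move=> c_range e_range y01 U m0_ge m0_le center m0_gt0; have /andP[c0 c1] := c_range.
elim: j => [|j IH] jN.
  by exists m0; split=> //; rewrite ?expr0 ?mul1r //; [case: center|split; lra].
have [m [m_gt0 Bm mm0 m0m [lm sm]]] := IH (ltnW jN).
have mR : 0 < m%:R :> R by rewrite ltr0n.
have c1' : 1 <= 1 + c by lra.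
have m0mN : m0%:R <= (1 + c) ^+ N * m%:R.
  by apply: le_trans m0m _; rewrite ler_pM2r // ler_weXn2l // ltnW.
have [m2 [m2_gt0 Bm2 m2m mm2 psim]] :=
  descent_step c_range e_range y01 U m0_ge m0_le center m_gt0 Bm mm0 m0mN.
clear center U.
have m2R : 0 < m2%:R :> R by rewrite ltr0n.
have cm : 0 < c * m%:R by rewrite mulr_gt0.
have m2m' : (m2 <= m)%N by rewrite -(ler_nat R); lra.
exists m2; split=> //.
- exact: leq_trans mm0.
- rewrite exprS (mulrC (1 + c)) -mulrA; apply: le_trans m0m _.
  by rewrite ler_wpM2l // exprn_ge0 //; lra.
have lm2 : c / 8 <= ln (m%:R : R) - ln m2%:R.
  have : ln (m2%:R : R) <= ln ((1 - c / 8) * m%:R) by apply: ler_lnr.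
  rewrite lnM ?posrE //; last by lra.
  have : ln (1 - c / 8) <= (1 - c / 8) - 1 by apply: ln_le_subr1; lra.
  lra.
have lm2' : ln (m%:R : R) - ln m2%:R <= (m%:R - m2%:R) / m2%:R.
  rewrite -ln_div ?posrE // mulrBl divff ?gt_eqF //.
  by apply: ln_le_subr1; rewrite divr_gt0.
have sm2 : (psin m - psin m2) / m%:R <=
    \sum_(1 <= n < m.+1) lambda n - \sum_(1 <= n < m2.+1) lambda n.
  rewrite /psin (@big_cat_nat _ _ _ m2.+1) //= [X in _ <= X - _](@big_cat_nat _ _ _ m2.+1) //=.
  rewrite addrAC subrr add0r addrAC subrr add0r mulr_suml.
  apply: ler_sum_nat => n /andP[m2n nm]; have n0 : (0 < n)%N by apply: leq_ltn_trans m2n.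
  by rewrite ler_wpM2l ?vonmangoldt_ge0 // lef_pV2 ?posrE ?ltr0n // ler_nat.
(* Going from [psin] to logarithmic mass loses at most the factor [m / m2 <= 11 / 10], and [7 / 4]
   divided by it still exceeds [3 / 2]. *)
have : 3 / 2 * ((m%:R - m2%:R) / m2%:R) <= (psin m - psin m2) / m%:R.
  rewrite ler_pdivlMr // mulrA mulrAC ler_pdivrMr //; apply: le_trans (ler_wpM2r (ltW m2R) psim).
  have d0 : 0 <= m%:R - m2%:R :> R by lra.
  have : (m%:R - m2%:R) * m%:R <= (m%:R - m2%:R) * (11 / 10 * m2%:R) :> R.
    rewrite ler_wpM2l //; apply: le_trans mm2 _; rewrite ler_pM2r //; lra.
  have := mulr_ge0 d0 (ltW m2R); lra.
move: (_ / m2%:R) (_ / m%:R) lm2' sm2 => w1 w2 lm2' sm2 w12.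
rewrite -natr1; split; lra.
Qed.

Lemma prime_power_short_interval (c : R) : 0 < c ->
  exists X0, forall X, (X0 <= X)%N ->
  exists p k, [/\ prime p, (0 < k)%N & (X%:R : R) < (p ^ k)%N%:R <= (1 + c) * X%:R].
Proof.
move=> c_gt0; wlog c1 : c c_gt0 / c <= 1 / 10.
  move=> /(_ (Num.min c (1 / 10))); rewrite lt_min c_gt0 ge_min lexx orbT.
  move=> /(_ (ltac:(lra)) isT)[X0 hX0]; exists X0 => X /hX0[p [k [pp k0 /andP[lo up]]]].
  exists p, k; split=> //; rewrite lo /=; apply: le_trans up _.
  by rewrite ler_wpM2r // lerD2l ge_min lexx.
(* Mertens bounds the mass between [m] and [m0] by [ln m0 - ln m + 12], and [descent] gives [3 / 2]
   times that difference of logarithms; so a difference above 24 is contradictory. *)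
pose N := (Num.truncn (200 / c)).+1.
have Nc : 24 < N%:R * (c / 8).
  have : 200 / c < N%:R by exact: truncnS_gt.
  by rewrite ltr_pdivrMr //; lra.
(* One factor beyond the [N] steps, since the intervals used in a step reach further by [1 + c]. *)
pose K : R := (1 + c) ^+ N.+1.
have K1 : 1 <= K by apply: exprn_ege1; lra.
have lK : 0 <= ln K by apply: ln_ge0.
pose eta' := c / 8; have eta'0 : 0 < eta' by rewrite /eta'; lra.
pose eta := eta' / (2 * (eta' + 2 * (ln K + 14))).
have eta0 : 0 < eta by rewrite divr_gt0 //; lra.
have eta1 : eta <= 1 / 2 by rewrite ler_pdivrMr; lra.
pose tau := c / 64; have tau0 : 0 < tau by rewrite /tau; lra.
pose e := eta * tau / 2.
have e0 : 0 < e by apply: divr_gt0; [exact: mulr_gt0|lra].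
have e1 : e <= tau / 3.
  have : eta * tau <= 1 / 2 * tau by rewrite ler_pM2r.
  by rewrite /e; lra.
have [y0 y01 U] := psi_short e0.
have c1' : 0 < c <= 1 by rewrite c_gt0; lra.
have eta1' : 0 < eta <= 1 by rewrite eta0; lra.
have tau1 : tau <= 1 by rewrite /tau; lra.
have [X1 mass] := deficient_mass c1' tau0 eta1' tau1 y01 U.
have [X2 center] := exists_sparse_center K1 y01 eta'0.
exists (maxn X1 X2) => X; rewrite geq_max => /andP[/mass {}mass XX2].
apply: contrapT => nex.
have noL n : X%:R < n%:R :> R -> n%:R <= (1 + c) * X%:R -> Lambda n = 0.
  move=> lo up; apply/eqP; apply: contrapT => /negP/vonmangoldt_neq0[p [k [pp k0 nE]]].
  by apply: nex; exists p, k; rewrite -nE lo up.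
have psiX : psi ((1 + c) * X%:R) = psi X%:R.
  apply/eqP; rewrite -subr_eq0 (@psi_diff _ _ _ (2 * X)) //; first last.
  - by rewrite natrM ler_wpM2r //; lra.
  - by rewrite ler_peMl //; lra.
  by rewrite big1 // => n /andP[]; apply: noL.
have [m0 [m0_ge m0_le sparse]] := center X _ XX2 (mass psiX).
have m0_gt0 : (0 < m0)%N.
  rewrite -(ltr0n R); apply: lt_le_trans m0_ge.
  by rewrite mulr_gt0 ?(lt_le_trans _ K1) ?(lt_le_trans _ y01).
have cr : 0 < c <= 1 / 10 by rewrite c_gt0.
have er : 0 < e <= c / 64 / 3 by rewrite e0.
have [m [m_gt0 _ mm0 _ [lm sm]]] :=
  descent cr er y01 U m0_ge m0_le sparse m0_gt0 (leqnn N).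
have /andP[_ up] := @mertens R m0 m0_gt0; have /andP[lo _] := @mertens R m m_gt0.
clear -lo up lm sm Nc; lra.
Qed.

End PrimePowerInShortInterval.

(** * The Frankl-Wilson bound *)

Lemma alternating_bin_sum (R : pzRingType) (u m : nat) :
  \sum_(i < m.+1) (- 1) ^+ i * 'C(u.+1, i)%:R = (- 1) ^+ m * 'C(u, m)%:R :> R.
Proof.
elim: m => [|m IH]; first by rewrite big_ord1 !bin0.
rewrite big_ord_recr /= IH binS natrD mulrDr addrCA exprS mulN1r.
by rewrite !mulNr subrr addr0.
Qed.

(** With [q = p ^ k], the product of [u + 1] and ['C(u, q - 1)] is a multiple of [q]; if [p] did not
    divide the binomial, [q] would divide [u + 1]. *)
Lemma prime_power_dvd_bin (p k u : nat) : prime p -> ~~ (p ^ k %| u.+1)%N ->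
  (p %| 'C(u, (p ^ k).-1))%N.
Proof.
move=> pp; apply: contraR => pC; have q0 : (0 < p ^ k)%N by rewrite expn_gt0 prime_gt0.
have := mul_bin_diag u.+1 (p ^ k).-1; rewrite /= prednK // => E.
have : (p ^ k %| u.+1 * 'C(u, (p ^ k).-1))%N by rewrite E dvdn_mulr.
by rewrite Gauss_dvdl // coprimeXl // prime_coprime.
Qed.

Lemma sum_small_subsets (V : nmodType) (T : finType) (A : {set T}) (q : nat) (F : nat -> V) :
  \sum_(S : {set T} | (S \subset A) && (#|S| < q)%N) F #|S| =
  \sum_(i < q) F i *+ 'C(#|A|, i).
Proof.
rewrite (partition_big (fun S : {set T} => inord #|S| : 'I_q.-1.+1) xpredT) //=.
case: q => [|q].
  by rewrite big_ord0 big1 // => i _; rewrite big_pred0 // => S; rewrite ltn0 andbF.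
apply: eq_bigr => i _.
rewrite (eq_bigl (fun S : {set T} =>
  S \in [set B : {set T} | B \subset A & #|B| == i]%SET)); last first.
  move=> S; rewrite inE -andbA; congr (_ && _); apply/andP/eqP => [[Sq /eqP <-]|SE].
    by rewrite inordK.
  by split; [rewrite SE ltn_ord | apply/eqP/val_inj; rewrite /= inordK SE // ltn_ord].
rewrite (eq_bigr (fun=> F i)) => [|S]; last by rewrite inE => /andP[_ /eqP ->].
by rewrite sumr_const cards_draws.
Qed.

(* Frankl and Wilson: modulo p, the matrix with entries
   sum_(S, |S| < q) (-1)^|S| [S included in A][S disjoint from B] is the identity. *)
Lemma frankl_wilson (n p k : nat) (F : {set {set 'I_n}}) : prime p ->
  {in F &, forall A B, A != B -> ~~ (p ^ k %| #|A :\: B|)%N} ->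
  (#|F| <= \sum_(i < p ^ k) 'C(n, i))%N.
Proof.
move=> pp FP; have q0 : (0 < p ^ k)%N by rewrite expn_gt0 prime_gt0.
set q := (p ^ k)%N in FP q0 *.
pose D := [set S : {set 'I_n} | (#|S| < q)%N]%SET.
pose P := \matrix_(i < #|F|, s < #|D|)
  ((-1) ^+ #|enum_val s| *+ (enum_val s \subset enum_val i) : 'F_p).
pose Q := \matrix_(s < #|D|, j < #|F|) ((enum_val s \subset ~: enum_val j)%:R : 'F_p).
have PQ : P *m Q = 1%:M.
  apply/matrixP => i j; rewrite !mxE.
  set A := enum_val i; set B := enum_val j.
  have AF : A \in F := enum_valP i; have BF : B \in F := enum_valP j.
  transitivity (\sum_(S : {set 'I_n} | (S \subset A :\: B) && (#|S| < q)%N) (-1) ^+ #|S| : 'F_p).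
    rewrite (eq_bigr (fun s : 'I_#|D| => (-1) ^+ #|enum_val s| *+ (enum_val s \subset A)
        * (enum_val s \subset ~: B)%:R)); last by move=> s _; rewrite !mxE.
    rewrite -(@big_enum_val _ _ _ _ (mem D) (fun S : {set 'I_n} =>
       (-1) ^+ #|S| *+ (S \subset A) * (S \subset ~: B)%:R)) /=.
    rewrite big_mkcond [RHS]big_mkcond; apply: eq_bigr => S _.
    rewrite inE finset.setDE finset.subsetI andbC; case: (_ < _)%N => //=.
    by case: (S \subset A); case: (S \subset ~: B); rewrite ?mulr1 ?mulr0 ?mul0r.
  (* On the diagonal only the empty set remains. Elsewhere the alternating sum is ['C(u, q - 1)] up
     to sign, with [u + 1] the size of [A :\: B]. *)
  rewrite (sum_small_subsets _ _ (fun i => (-1) ^+ i : 'F_p)).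
  case: eqVneq => [ij|ij].
    rewrite /A /B ij finset.setDv cards0; case: (q) q0 => // q' _.
    by rewrite big_ord_recl big1 ?addr0 ?expr0 ?bin0.
  have AB : A != B by apply: contra ij => /eqP/enum_val_inj ->.
  have := FP A B AF BF AB; case: #|A :\: B| => [|u]; first by rewrite dvdn0.
  move=> qu; rewrite -(prednK q0).
  under eq_bigr do rewrite -mulr_natr.
  rewrite alternating_bin_sum; apply/eqP; rewrite mulf_eq0; apply/orP; right.
  by rewrite -(dvdn_pcharf (pchar_Fp pp)) prime_power_dvd_bin.
(* The identity matrix of size [#|F|] factors through dimension [#|D|]. *)
have : (\rank (P *m Q) <= #|D|)%N by apply: leq_trans (mxrankM_maxl _ _) (rank_leq_col _).
rewrite PQ mxrank1 => /leq_trans; apply; rewrite leq_eqVlt; apply/orP; left; apply/eqP.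
have := @sum_small_subsets nat _ [set: 'I_n]%SET q (fun=> 1%N).
rewrite cardsT card_ord => E.
rewrite -sum1_card; transitivity (\sum_(i < q) 1%N *+ 'C(n, i))%R; last first.
  by apply: eq_bigr => i _; rewrite -[RHS]natn.
by rewrite -E; apply: eq_bigl => S; rewrite inE finset.subsetT.
Qed.

(** Every colour class meets the condition of [frankl_wilson]: for distinct members the size of
    [A :\: B] is positive, less than [2 * p ^ k] and different from [p ^ k]. *)
Lemma colored_slice_bound (n w m p k : nat) (c : {set 'I_n} -> nat) : prime p ->
  (w < 2 * p ^ k)%N ->
  (forall A : {set 'I_n}, #|A| = w -> (c A < m)%N) ->
  (forall A B : {set 'I_n}, #|A| = w -> #|B| = w -> #|A :\: B| = (p ^ k)%N -> c A <> c B) ->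
  ('C(n, w) <= m * \sum_(i < p ^ k) 'C(n, i))%N.
Proof.
move=> pp w2q cm cP.
have -> : 'C(n, w) = #|[set A : {set 'I_n} | #|A| == w]%SET| by rewrite card_draws card_ord.
rewrite -sum1_card (partition_big (fun A : {set 'I_n} => inord (c A) : 'I_m.-1.+1) xpredT) //=.
(* [inord] needs a nonempty range of colours; with no colour there is no set of size [w]. *)
case: m cm => [|m] cm.
  rewrite mul0n big1 // => i _; rewrite big_pred0 // => A; rewrite inE.
  by case: eqP => // /cm.
rewrite /= -[X in (X * _)%N]card_ord -sum_nat_const; apply: leq_sum => i _.
rewrite sum1dep_card; apply: frankl_wilson => // A B.
rewrite !inE => /andP[/eqP Aw /eqP cA] /andP[/eqP Bw /eqP cB] AB.
have cAB : c A = c B.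
  by have := congr1 val (etrans cA (esym cB)); rewrite /= !inordK ?ltnS ?cm // -ltnS cm.
have ABle : (#|A :\: B| <= w)%N by rewrite -Aw subset_leq_card // finset.subsetDl.
have AB0 : (0 < #|A :\: B|)%N.
  rewrite card_gt0 finset.setD_eq0; apply: contra AB => AsB.
  by rewrite eqEcard AsB Aw Bw leqnn.
apply/negP => /dvdnP[[|[|d]] E].
- by rewrite E in AB0.
- by apply: (cP A B) => //; rewrite E mul1n.
- move: w2q; rewrite ltnNge => /negP; apply; apply: leq_trans ABle.
  by rewrite E leq_mul2r orbT.
Qed.

(** * Johnson graphs as distance graphs *)

Lemma sqr_sum_le (R : realDomainType) (n : nat) (s : 'I_n -> R) :
  (\sum_j s j) ^+ 2 <= n%:R * \sum_j s j ^+ 2.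
Proof.
case: n s => [|n] s; first by rewrite !big_ord0 expr0n mulr0.
rewrite -(@ler_pM2l _ n.+1%:R) ?ltr0n // -subr_ge0.
set T := \sum_j s j; set Q := \sum_j _.
suff <- : \sum_j (n.+1%:R * s j - T) ^+ 2 = n.+1%:R * (n.+1%:R * Q) - n.+1%:R * T ^+ 2.
  by apply: sumr_ge0 => j _; apply: sqr_ge0.
transitivity (\sum_j (n.+1%:R ^+ 2 * s j ^+ 2 - 2 * n.+1%:R * T * s j + T ^+ 2)).
  by apply: eq_bigr => j _; ring.
rewrite big_split sumrB /= -!mulr_sumr sumr_const card_ord -/T -/Q -mulr_natl; ring.
Qed.

(** Cauchy-Schwarz for [s j], the number of sets containing [j]: its sum is [m * w], and its squares
    add up the pairwise intersections, of size [w] or [w - q]. A common factor [m] cancels. *)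
Lemma equidistant_sets_bound (R : realDomainType) (n w q m : nat) (A : 'I_m -> {set 'I_n}) :
  (0 < m)%N -> (forall i, #|A i| = w) -> (forall i j, i != j -> #|A i :\: A j| = q) ->
  m%:R * w%:R ^+ 2 <= n%:R * (w%:R + (m%:R - 1) * (w%:R - q%:R)) :> R.
Proof.
move=> m0 Aw Aq; pose s (j : 'I_n) : R := \sum_i (j \in A i)%:R.
have cardE (B : {set 'I_n}) : \sum_j (j \in B)%:R = #|B|%:R :> R.
  by rewrite -sum1_card natr_sum [RHS]big_mkcond; apply: eq_bigr => j _; case: (j \in B).
have sumE : \sum_j s j = m%:R * w%:R.
  rewrite exchange_big /= (eq_bigr (fun=> w%:R)) => [|i _]; last by rewrite cardE Aw.
  by rewrite sumr_const card_ord mulr_natl.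
have sqrE : \sum_j s j ^+ 2 = m%:R * (w%:R + (m%:R - 1) * (w%:R - q%:R)).
  transitivity (\sum_i \sum_i' (#|A i :&: A i'|%:R : R)).
    under eq_bigr => j _ do rewrite expr2 /s mulr_suml.
    rewrite exchange_big; apply: eq_bigr => i _ /=.
    under eq_bigr => j _ do rewrite mulr_sumr.
    rewrite exchange_big; apply: eq_bigr => i' _ /=; rewrite -cardE.
    apply: eq_bigr => j _; rewrite inE.
    by case: (j \in A i); case: (j \in A i'); rewrite ?mul1r ?mul0r.
  rewrite (eq_bigr (fun=> w%:R + (m%:R - 1) * (w%:R - q%:R))) => [|i _].
    by rewrite sumr_const card_ord mulr_natl.
  rewrite (bigD1 i) //= finset.setIid Aw; congr (_ + _).
  rewrite (eq_bigr (fun=> w%:R - q%:R)) => [|i' i'i]; last first.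
    have -> : w = (#|A i :&: A i'| + q)%N by rewrite -(Aq i i') 1?eq_sym // cardsID Aw.
    by rewrite natrD addrK.
  rewrite sumr_const cardC1 card_ord -[LHS]mulr_natl; congr (_ * _).
  by rewrite -subn1 natrB.
have := sqr_sum_le s; rewrite sumE sqrE exprMn expr2 -mulrA mulrCA [leRHS]mulrCA.
by rewrite ler_pM2l ?ltr0n.
Qed.

Section JohnsonGraph.
Context (R : realType) (n w q : nat).

Definition charvec (A : {set 'I_n}) : 'rV[R]_n := \row_i (i \in A)%:R.

Lemma charvec_inj : injective charvec.
Proof.
move=> A B /rowP AB; apply/setP => i; have := AB i; rewrite !mxE.
by case: (i \in A); case: (i \in B) => // /eqP; rewrite ?oner_eq0 // eq_sym oner_eq0.
Qed.

Lemma enorm_charvec A B :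
  enorm (charvec A - charvec B) = Num.sqrt (#|A :\: B| + #|B :\: A|)%N%:R.
Proof.
rewrite /enorm; congr Num.sqrt; rewrite natrD -!sum1_card !natr_sum.
rewrite [X in _ = X + _]big_mkcond [X in _ = _ + X]big_mkcond -big_split /=; apply: eq_bigr => i _.
rewrite !mxE !inE; case: (i \in A); case: (i \in B) => /=;
  by rewrite ?subrr ?subr0 ?sub0r ?sqrrN ?expr0n ?expr1n ?addr0 ?add0r.
Qed.

(** A generalized Johnson graph; as all supports have size [w], adjacent vertices lie at distance
    the square root of [2 * q]. *)
Definition johnson_graph : graph 'rV[R]_n := Graph
  [set charvec A | A in [set A : {set 'I_n} | #|A| = w]]
  [set e | exists A B : {set 'I_n},
     [/\ #|A| = w, #|B| = w, #|A :\: B| = q & e = [set charvec A; charvec B]]].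

Lemma cardsD_sym (A B : {set 'I_n}) : #|A| = #|B| -> #|A :\: B| = #|B :\: A|.
Proof.
move=> AB; apply/eqP.
by rewrite -(eqn_add2l #|A :&: B|) cardsID finset.setIC cardsID AB.
Qed.

Lemma johnson_edge (A B : {set 'I_n}) : A <> B ->
  edges johnson_graph [set charvec A; charvec B] -> #|A :\: B| = q.
Proof.
move=> AB [A' [B' [Aw Bw Aq E]]].
have inA : [set charvec A'; charvec B'] (charvec A) by rewrite -E; left.
have inB : [set charvec A'; charvec B'] (charvec B) by rewrite -E; right.
move: inA inB => /= [/charvec_inj AE|/charvec_inj AE] [/charvec_inj BE|/charvec_inj BE].
- by case: AB; rewrite AE BE.
- by rewrite AE BE.
- by rewrite AE BE cardsD_sym // Aw.
- by case: AB; rewrite AE BE.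
Qed.

Lemma johnson_distance_graph : (0 < q)%N -> distance_graph johnson_graph.
Proof.
move=> q0; exists (Num.sqrt (q + q)%N%:R); first by rewrite sqrtr_gt0 ltr0n addn_gt0 q0.
move=> _ [A [B [Aw Bw Aq ->]]]; exists (charvec A), (charvec B); split => //.
- by exists A.
- by exists B.
- by rewrite enorm_charvec (@cardsD_sym B) ?Aw // Aq.
Qed.

Lemma johnson_chromatic_ge (p k : nat) : prime p -> q = (p ^ k)%N -> (w < 2 * q)%N ->
  (('C(n, w)%:R / (\sum_(i < q) 'C(n, i))%N%:R)%:E <= chromatic_number R johnson_graph)%E.
Proof.
move=> pp qE w2q; apply: le_ereal_inf_tmp => _ [m [c cm cP] <-].
rewrite lee_fin ler_pdivrMr ?ltr0n; last first.
  have : (0 < q)%N by rewrite qE expn_gt0 prime_gt0.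
  by case: (q) => // q' _; rewrite big_ord_recl bin0.
rewrite -natrM ler_nat qE.
apply: (@colored_slice_bound _ _ _ _ _ (fun A => c (charvec A))) => //.
- by rewrite -qE.
- by move=> A Aw; apply: cm; exists A.
- move=> A B Aw Bw AB; apply: cP; [by exists A|by exists B|].
  by exists A, B; split=> //; rewrite AB.
Qed.

Lemma johnson_clique_bound (m : nat) (K : set 'rV[R]_n) : (0 < m)%N ->
  clique johnson_graph K -> (K #= `I_m)%card ->
  m%:R * w%:R ^+ 2 <= n%:R * (w%:R + (m%:R - 1) * (w%:R - q%:R)) :> R.
Proof.
move=> m0 [KV KE]; rewrite card_eq_sym => /card_set_bijP[f [fK finj _]].
have /choice[A AP] : forall i : 'I_m, exists A : {set 'I_n}, #|A| = w /\ charvec A = f i.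
  move=> i; have /KV[A Aw Af] : K (f i) by apply: fK => /=.
  by exists A.
apply: (@equidistant_sets_bound _ _ _ _ _ A) => // [i|i j ij]; first by have [] := AP i.
have fij : f i <> f j.
  by move=> /finj; rewrite !inE /= => /(_ (ltn_ord i) (ltn_ord j))/val_inj/eqP; apply/negP.
have [_ Ai] := AP i; have [_ Aj] := AP j.
apply: johnson_edge; first by move=> AE; apply: fij; rewrite -Ai -Aj AE.
by rewrite Ai Aj; apply: KE => //; apply: fK => /=.
Qed.

End JohnsonGraph.

(** Sizes are integers, hence at most [k - 1], so the supremum remains strictly below [k]. *)
Lemma clique_number_lt (R : realType) (T : Type) (G : graph T) (k : int) :
  (forall m K, clique G K -> (K #= `I_m)%card -> m%:Z < k) ->
  (clique_number R G < (k%:~R)%:E)%E.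
Proof.
move=> Gk; apply: (@le_lt_trans _ _ ((k - 1)%:~R)%:E); last first.
  by rewrite lte_fin ltr_int; lia.
apply: ge_ereal_sup => _ [m [K KG Km] <-].
have := Gk m K KG Km => mk; rewrite lee_fin -[m%:R]/(m%:Z%:~R) ler_int; lia.
Qed.

(** Serves the finitely many small dimensions, and every dimension when the base to be reached is at
    most 1. *)
Lemma single_vertex_graph (R : realType) (n : nat) (k : int) : 1 < k ->
  exists G : graph 'rV[R]_n, [/\ distance_graph G,
    (clique_number R G < (k%:~R)%:E)%E & (1%:E <= chromatic_number R G)%E].
Proof.
move=> k1; exists (Graph [set (0 : 'rV[R]_n)] set0); split.
- by exists 1 => // e.
- apply: clique_number_lt => m K [K0 _]; rewrite card_eq_sym => /card_set_bijP[f [fK finj _]].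
  have : (m <= 1)%N.
    rewrite leqNgt; apply/negP => m1; have f0 i : (i < m)%N -> f i = 0.
      by move=> im; apply: K0; apply: fK.
    have := finj 0%N 1%N; rewrite !inE /= => /(_ (ltnW m1) m1).
    by rewrite !f0 ?(ltnW m1) // => /(_ erefl).
  lia.
apply: le_ereal_inf_tmp => _ [m [c cm _] <-]; rewrite lee_fin ler1n.
by apply: leq_ltn_trans (cm 0 erefl).
Qed.

(** * Entropy *)

Section Entropy.
Context {R : realType}.
Implicit Types (x y p b : R).

(** The negative of the binary entropy, with natural logarithms. *)
Definition nentropy x : R := x * ln x + (1 - x) * ln (1 - x).

Lemma powR_nentropy x : 0 < x -> x < 1 -> x `^ x * (1 - x) `^ (1 - x) = expR (nentropy x).
Proof. by move=> x0 x1; rewrite /powR !gt_eqF ?subr_gt0 // expRD. Qed.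

(** Gibbs' inequality puts [nentropy] above its tangent at [p], whose slope [ln p - ln (1 - p)] is
    nonnegative. *)
Lemma nentropy_le p b : 1 / 2 <= p -> p <= b -> b < 1 -> nentropy p <= nentropy b.
Proof.
move=> p2 pb b1; have p0 : 0 < p by lra.
have gibbs x y : 0 < x -> 0 < y -> x * (ln y - ln x) <= y - x.
  move=> x0 y0; rewrite -ln_div ?posrE //.
  have : ln (y / x) <= y / x - 1 by apply: ln_le_subr1; rewrite divr_gt0.
  rewrite -(ler_pM2l x0) => /le_trans; apply.
  by rewrite mulrBr mulrCA divff ?gt_eqF // !mulr1.
have g1 := @gibbs b p (ltac:(lra)) p0.
have g2 := @gibbs (1 - b) (1 - p) (ltac:(lra)) (ltac:(lra)).
have : 0 <= (b - p) * (ln p - ln (1 - p)).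
  rewrite mulr_ge0 ?subr_ge0 // ler_lnr //; lra.
by rewrite /nentropy; lra.
Qed.

(** Chernoff's bound: in the expansion of [((1 - p) + p) ^ n] the weight of each term with [i < q]
    is at least [expR (n * nentropy p)], because [i <= p * n] and [p <= 1 / 2]. *)
Lemma bin_sum_le p (n q : nat) : 0 < p -> p <= 1 / 2 -> q%:R <= p * n%:R ->
  (\sum_(i < q) 'C(n, i))%N%:R <= expR (- (n%:R * nentropy p)).
Proof.
move=> p0 p2 qn; have qn' : (q <= n)%N.
  rewrite -(ler_nat R) (le_trans qn) // ler_piMl //; lra.
rewrite expRN -[leRHS]mul1r ler_pdivlMr ?expR_gt0 //.
rewrite -[leRHS](_ : ((1 - p) + p) ^+ n = 1); last by rewrite subrK expr1n.
rewrite exprDn natr_sum mulr_suml.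
rewrite -(big_mkord xpredT (fun i => 'C(n, i)%:R * expR (n%:R * nentropy p))).
rewrite -(big_mkord xpredT (fun i => ((1 - p) ^+ (n - i) * p ^+ i) *+ 'C(n, i))).
rewrite [leRHS](@big_cat_nat _ _ _ q) //=; last exact: leqW.
rewrite -[leLHS]addr0 lerD //; last first.
  by apply: sumr_ge0 => i _; rewrite mulrn_wge0 // mulr_ge0 // exprn_ge0 //; lra.
apply: ler_sum_nat => i /andP[_ iq]; rewrite -[leRHS]mulr_natl ler_wpM2l //.
have ii : (i <= n)%N by apply: leq_trans qn'; apply: ltnW.
have -> : (1 - p) ^+ (n - i) * p ^+ i = expR ((n - i)%N%:R * ln (1 - p) + i%:R * ln p).
  by rewrite expRD !expRM_natl !lnK // posrE; lra.
rewrite ler_expR natrB // /nentropy.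
have lp : ln p <= ln (1 - p) by apply: ler_lnr => //; lra.
have ipn : i%:R <= p * n%:R by apply: le_trans qn; rewrite ler_nat ltnW.
have := mulr_ge0 (_ : 0 <= p * n%:R - i%:R) (_ : 0 <= ln (1 - p) - ln p).
by rewrite !subr_ge0 => /(_ ipn lp); lra.
Qed.

(** Stirling's bounds for three factorials: those of [w] and [n - w] cost 2 and [2 * ln n], while
    rounding [b * n] down to [w] costs [(1 - b)^-1 - ln b]. *)
Lemma bin_ge b (n w : nat) : 0 < b -> b < 1 -> (0 < w)%N -> (w < n)%N ->
  w%:R <= b * n%:R -> b * n%:R <= w%:R + 1 ->
  expR (- (n%:R * nentropy b) - (2 + (1 - b)^-1 - ln b) - 2 * ln n%:R) <= 'C(n, w)%:R.
Proof.
move=> b0 b1 w0 wn wb bw; have n0 : (0 < n)%N by apply: leq_trans wn.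
have nw0 : (0 < n - w)%N by rewrite subn_gt0.
have nR : 0 < n%:R :> R by rewrite ltr0n.
have wR : 0 < w%:R :> R by rewrite ltr0n.
have nwR : 0 < (n - w)%N%:R :> R by rewrite ltr0n.
have Cpos : 0 < 'C(n, w)%:R :> R by rewrite ltr0n bin_gt0 ltnW.
rewrite -[leRHS]lnK ?posrE // ler_expR.
have CE : ln ('C(n, w)%:R : R) = lnfact n - lnfact w - lnfact (n - w).
  rewrite !lnfactE -(bin_fact (ltnW wn)) !natrM !lnM ?posrE ?mulr_gt0 ?ltr0n ?fact_gt0 //.
    by ring.
  by rewrite bin_gt0 ltnW.
rewrite CE.
have /andP[lon _] := @lnfact_bounds R n n0.
have /andP[_ upw] := @lnfact_bounds R w w0.
have /andP[_ upnw] := @lnfact_bounds R (n - w) nw0.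
have nwE : (n - w)%N%:R = n%:R - w%:R :> R by rewrite natrB // ltnW.
have lb : ln b <= 0 by apply: ln_le0; lra.
have l1b : ln (1 - b) <= 0 by apply: ln_le0; lra.
have b1' : 0 < 1 - b by lra.
have lw : ln (w%:R : R) <= ln b + ln n%:R.
  by rewrite -lnM ?posrE //; apply: ler_lnr.
have lwn : ln (w%:R : R) <= ln n%:R by apply: ler_lnr => //; rewrite ler_nat ltnW.
have lnwn : ln ((n - w)%N%:R : R) <= ln n%:R by apply: ler_lnr => //; rewrite ler_nat leq_subr.
set s := (1 - b)^-1.
have s0 : 0 < s by rewrite invr_gt0.
have sE : s * (1 - b) = 1 by rewrite mulVf // gt_eqF.
have lnw : ln ((n - w)%N%:R : R) <= ln (1 - b) + ln n%:R + s / n%:R.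
  have : ln ((n - w)%N%:R : R) <= ln ((1 - b) * (n%:R * (1 + s / n%:R))).
    apply: ler_lnr => //; rewrite mulrDr mulr1 mulrCA divff ?gt_eqF // mulr1 mulrDr.
    by rewrite nwE (mulrC _ s) sE; lra.
  have sn0 : 0 < s / n%:R by rewrite divr_gt0.
  rewrite lnM ?posrE ?mulr_gt0 //; last by lra.
  rewrite lnM ?posrE //; last by lra.
  have : ln (1 + s / n%:R) <= s / n%:R by apply: le_ln1Dx; lra.
  lra.
have h1 : w%:R * ln w%:R <= w%:R * (ln b + ln n%:R) :> R by rewrite ler_pM2l.
have h2 : (n - w)%N%:R * ln (n - w)%N%:R <=
    (n - w)%N%:R * (ln (1 - b) + ln n%:R) + s.
  apply: le_trans (ler_wpM2l (ltW nwR) lnw) _; rewrite mulrDr lerD2l mulrCA.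
  by rewrite ler_piMr ?(ltW s0) // ler_pdivrMr // mul1r ler_nat leq_subr.
have h3 : (w%:R + 1 - b * n%:R) * ln b <= 0 by rewrite mulr_ge0_le0 //; lra.
have h4 : ((n - w)%N%:R - (1 - b) * n%:R) * ln (1 - b) <= 0.
  by rewrite mulr_ge0_le0 // nwE; lra.
rewrite nwE in upnw h2 h4 lnwn *; rewrite /nentropy.
lra.
Qed.

End Entropy.

(** * Clique bound and choice of parameters *)

Lemma clique_size_bound (R : realType) (n w q m : nat) (b p c kappa : R) :
  (0 < m)%N -> 0 < b -> b < 1 -> 0 < p -> 2 <= kappa ->
  kappa * (b - b ^+ 2) <= (kappa - 1) * p ->
  0 < c -> c * kappa ^+ 2 <= 1 / 2 -> c <= 1 ->
  4 * kappa * (kappa + 1) < p * n%:R ->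
  w%:R <= b * n%:R -> b * n%:R <= w%:R + 1 -> p * n%:R < (1 + c) * q%:R ->
  m%:R * w%:R ^+ 2 <= n%:R * (w%:R + (m%:R - 1) * (w%:R - q%:R)) :> R ->
  m%:R < kappa + 1.
Proof.
move=> m0 b0 b1 p0 k2 kp c0 ck c1 nbig wb bw qp ineq.
(* To leading order [m >= kappa + 1] would give [kappa ^ 2 * q <= (kappa ^ 2 - 1) * p * n], with [q]
   within a factor [1 + c] of [p * n]. As [c * kappa ^ 2 <= 1 / 2], a gap of [p * n / 2] remains,
   more than the lower-order terms. *)
rewrite ltNge; apply/negP => km.
have nR0 : 0 <= n%:R :> R by [].
have nR : 0 < n%:R :> R.
  rewrite lt_def nR0 andbT; apply/eqP => n0; move: nbig; rewrite n0 mulr0.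
  by apply/negP; rewrite -leNgt !mulr_ge0 //; lra.
move: n%:R w%:R q%:R m%:R nR nR0 nbig wb bw qp ineq km => N W Q M N0 _ nbig wb bw qp ineq km.
have M0 : 0 < M by lra.
have Q0 : 0 < Q.
  have := lt_trans (mulr_gt0 p0 N0) qp; rewrite pmulr_rgt0 //; lra.
have WN : W * (N - W) <= (b - b ^+ 2) * N ^+ 2 + N.
  have t0 : 0 <= b * N - W by lra.
  have t1 : b * N - W <= 1 by lra.
  have -> : W * (N - W) = (b - b ^+ 2) * N ^+ 2
     + (2 * b - 1) * (b * N - W) * N - (b * N - W) ^+ 2 by ring.
  have : (2 * b - 1) * (b * N - W) * N <= 1 * N.
    rewrite ler_pM2r //; apply: le_trans (_ : 1 * (b * N - W) <= _); last by lra.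
    by rewrite ler_wpM2r //; lra.
  by have := sqr_ge0 (b * N - W); lra.
have s1 : N * ((M - 1) * Q) <= N * (M * ((b - b ^+ 2) * N + 1)).
  have : M * (W * (N - W)) <= M * ((b - b ^+ 2) * N ^+ 2 + N) by rewrite ler_pM2l.
  by move: ineq; rewrite !expr2; lra.
rewrite ler_pM2l // in s1.
have k0 : 0 < kappa by lra.
(* The ratio [M / (M - 1)] is largest at [M = kappa + 1]. *)
have s2 : kappa * Q <= (kappa + 1) * ((b - b ^+ 2) * N + 1).
  rewrite -(ler_pM2l M0); apply: (@le_trans _ _ ((kappa + 1) * ((M - 1) * Q))); last first.
    by rewrite [leRHS]mulrCA ler_pM2l //; lra.
  have : 0 <= (M - (kappa + 1)) * Q by rewrite mulr_ge0 //; lra.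
  lra.
have s3 : kappa * (kappa * Q) <= (kappa + 1) * ((kappa - 1) * p * N + kappa).
  have : kappa * (kappa * Q) <= kappa * ((kappa + 1) * ((b - b ^+ 2) * N + 1)) by rewrite ler_pM2l.
  have : (kappa + 1) * N * (kappa * (b - b ^+ 2)) <= (kappa + 1) * N * ((kappa - 1) * p).
    by rewrite ler_pM2l // mulr_gt0 //; lra.
  lra.
have s4 : kappa ^+ 2 * (p * N) <= (1 + c) * ((kappa + 1) * ((kappa - 1) * p * N + kappa)).
  apply: (@le_trans _ _ (kappa ^+ 2 * ((1 + c) * Q))).
    by rewrite ler_pM2l ?exprn_gt0 // ltW.
  by rewrite mulrCA ler_pM2l ?expr2 -?mulrA //; lra.
have s5 : (1 + c) * (kappa ^+ 2 - 1) <= kappa ^+ 2 - 1 / 2 by lra.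
have pN : 0 < p * N by rewrite mulr_gt0.
have s6 : (1 + c) * (kappa ^+ 2 - 1) * (p * N) <= (kappa ^+ 2 - 1 / 2) * (p * N).
  by rewrite ler_pM2r.
have kk : 0 < (kappa + 1) * kappa by rewrite mulr_gt0 //; lra.
have s7 : (1 + c) * ((kappa + 1) * kappa) <= 2 * ((kappa + 1) * kappa).
  by rewrite ler_pM2r //; lra.
move: s4 s6; rewrite !expr2; lra.
Qed.

Lemma distance_graphs_in_large_dimension (R : realType) (k : int) (a b z : R) :
  3 <= k -> 0 < a -> 0 < b -> b < 1 -> 2 * a < b -> b - a <= 1 / 2 ->
  (k - 1)%:~R * (b - b ^+ 2) <= ((k - 1)%:~R - 1) * (b - a) ->
  0 < z -> z < expR (nentropy (b - a) - nentropy b) ->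
  exists n0, forall n, (n0 <= n)%N -> exists G : graph 'rV[R]_n,
    [/\ distance_graph G, (clique_number R G < (k%:~R)%:E)%E &
        ((z ^+ n)%:E <= chromatic_number R G)%E].
Proof.
move=> k3 a0 b0 b1 ab p2 kp z0 zV; set p := b - a in p2 kp zV *.
set kappa : R := (k - 1)%:~R in kp *.
have kappa2 : 2 <= kappa by rewrite -[2]/(2%:Z%:~R) ler_int lerBrDr.
have kE : kappa + 1 = k%:~R by rewrite /kappa -[X in _ + X]/(1%:~R) -intrD subrK.
have p0 : 0 < p by rewrite /p; lra.
have pb : b < 2 * p by rewrite /p; lra.
have k0 : 0 < kappa by lra.
(* The first bound on [c] yields [w < 2 * q], the second the clique bound. *)
pose c := Num.min (2 * p / b - 1) (1 / (2 * kappa ^+ 2)).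
have c0 : 0 < c.
  rewrite lt_min; apply/andP; split; first by rewrite subr_gt0 ltr_pdivlMr // mul1r.
  by rewrite divr_gt0 // mulr_gt0 // exprn_gt0.
have cb : (1 + c) * b <= 2 * p.
  by rewrite -ler_pdivlMr // -lerBrDl ge_min lexx.
have ck : c * kappa ^+ 2 <= 1 / 2.
  rewrite -ler_pdivlMr ?exprn_gt0 // ge_min; apply/orP; right.
  by rewrite !div1r invfM.
have c1 : c <= 1.
  have : 1 <= kappa ^+ 2 by rewrite exprn_ege1 //; lra.
  have : c * 1 <= c * kappa ^+ 2 -> c <= 1 / 2 by lra.
  by move=> h k1; have := h (ler_wpM2l (ltW c0) k1); lra.
have [X0 hX0] := prime_power_short_interval c0.
pose d := nentropy p - nentropy b - ln z.
have d0 : 0 < d.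
  by rewrite subr_gt0 -ltr_expR lnK ?posrE.
pose D := 2 + (1 - b)^-1 - ln b.
pose s0 := 1 + (`|D| + 4) / d.
have s01 : 0 <= (`|D| + 4) / d by apply: divr_ge0; [apply: addr_ge0|exact: ltW].
(* The summands provide in turn a prime power, the clique bound, [w > 0], and a square root of [n]
   above [s0]. *)
pose T := X0%:R * (1 + c) / p + 4 * kappa * (kappa + 1) / p + 1 / b + s0 ^+ 2.
exists (Num.truncn T).+1 => n n0.
have {n0} nT : T < n%:R by apply: lt_le_trans (truncnS_gt T) _; rewrite ler_nat.
have T1 : 0 <= X0%:R * (1 + c) / p by rewrite divr_ge0 ?mulr_ge0 //; lra.
have T2 : 0 <= 4 * kappa * (kappa + 1) / p by rewrite divr_ge0 ?mulr_ge0 //; lra.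
have T3 : 0 <= 1 / b by rewrite divr_ge0 //; lra.
have T4 : 0 <= s0 ^+ 2 by apply: sqr_ge0.
have n1 : X0%:R * (1 + c) < p * n%:R.
  by rewrite [ltRHS]mulrC -ltr_pdivrMr // (le_lt_trans _ nT) // /T; lra.
have n2 : 4 * kappa * (kappa + 1) < p * n%:R.
  by rewrite [ltRHS]mulrC -ltr_pdivrMr // (le_lt_trans _ nT) // /T; lra.
have n3 : 1 < b * n%:R by rewrite mulrC -ltr_pdivrMr // (le_lt_trans _ nT) // /T; lra.
have n4 : s0 ^+ 2 < n%:R by rewrite (le_lt_trans _ nT) // /T; lra.
have nR : 0 < n%:R :> R by rewrite (le_lt_trans T4).
clear nT T1 T2 T3 T4 T.
have c1' : 0 < 1 + c by lra.
(* A prime power [q] in the interval from [X] to [(1 + c) * X] is then at most [p * n]; being an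
   integer above [X], it also exceeds [p * n / (1 + c)]. *)
set X := Num.truncn (p * n%:R / (1 + c)).
have pn0 : 0 <= p * n%:R / (1 + c) by rewrite divr_ge0 ?mulr_ge0 //; lra.
have /andP[Xp pX] := truncn_itv pn0; rewrite -/X in Xp pX.
have XX0 : (X0 <= X)%N by rewrite truncn_ge_nat // ler_pdivlMr // ltW.
have [r [l [rp l0 /andP[Xq qX]]]] := hX0 X XX0.
pose q := (r ^ l)%N.
have qpn : q%:R <= p * n%:R.
  by apply: le_trans qX _; rewrite mulrC -ler_pdivlMr.
have pnq : p * n%:R < (1 + c) * q%:R.
  rewrite [ltRHS]mulrC -ltr_pdivrMr //; apply: lt_le_trans pX _.
  by rewrite ler_nat -(ltr_nat R).
have q0 : (0 < q)%N by rewrite expn_gt0 prime_gt0.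
have bn0 : 0 <= b * n%:R by lra.
set w := Num.truncn (b * n%:R).
have /andP[wb bw] := truncn_itv bn0; rewrite -/w -natr1 in wb bw.
have w0 : (0 < w)%N by rewrite truncn_gt0 ltW.
have wn : (w < n)%N by rewrite -(ltr_nat R) (le_lt_trans wb) // gtr_pMl.
have w2q : (w < 2 * q)%N.
  rewrite -(ltr_nat R) natrM; apply: le_lt_trans wb _.
  rewrite -(ltr_pM2l c1') mulrA; apply: (@le_lt_trans _ _ (2 * p * n%:R)).
    by rewrite mulrA ler_pM2r.
  lra.
exists (johnson_graph R n w q); split.
- exact: johnson_distance_graph.
- apply: clique_number_lt => m K KG Km.
  have [->|m0] := posnP m; first exact: lt_le_trans k3.
  have := johnson_clique_bound m0 KG Km.
  move=> /(clique_size_bound m0 b0 b1 p0 kappa2 kp c0 ck c1 n2 wb (ltW bw) pnq).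
  by rewrite kE -[m%:R]/(m%:Z%:~R) ltr_int.
apply: (le_trans _ (johnson_chromatic_ge R n rp erefl w2q)).
rewrite lee_fin; have S0 : 0 < (\sum_(i < q) 'C(n, i))%N%:R :> R.
  by rewrite ltr0n; case: (q) q0 => // q' _; rewrite big_ord_recl bin0.
rewrite ler_pdivlMr //.
apply: le_trans (ler_wpM2l _ (bin_sum_le p0 p2 qpn)) _; first by rewrite exprn_ge0 // ltW.
apply: le_trans (bin_ge b0 b1 w0 wn wb (ltW bw)).
rewrite -[z]lnK ?posrE // -expRM_natl -expRD ler_expR -/D.
have := ln_le_sqrt nR; set s := Num.sqrt n%:R => ls.
have sn : s ^+ 2 = n%:R by rewrite sqr_sqrtr // ltW.
have ss0 : s0 <= s.
  rewrite -ler_sqr ?nnegrE ?sqrtr_ge0 ?sn ?(ltW n4) //.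
  by rewrite /s0 addr_ge0.
have : D <= `|D| by apply: ler_norm.
have D0 : 0 <= `|D| by [].
have s1 : 1 <= s by rewrite /s0 in ss0; lra.
(* The exponential gain [d * n] outweighs the constant [D] and [2 * ln n <= 4 * s]. *)
have : `|D| + 4 * s <= d * s ^+ 2.
  have : (`|D| + 4) * s <= d * s * s.
    rewrite ler_wpM2r //; first by lra.
    by rewrite mulrC -ler_pdivrMr //; rewrite /s0 in ss0; lra.
  have : `|D| * 1 <= `|D| * s by rewrite ler_wpM2l.
  lra.
rewrite sn /d; lra.
Qed.

Theorem theorem4 (R : realType) (k : int) (a b : R)
  (hk : 3 <= k)
  (ha0 : 0 < a) (ha1 : a < 1)
  (hb0 : 0 < b) (hb1 : b < 1)
  (hba : 2 * a < b)
  (hb2a : a < b ^+ 2)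
  (hceil : Num.ceil ((b - a) / (b ^+ 2 - a)) < k) :
  ((((b - a) `^ (b - a) * (1 - b + a) `^ (1 - b + a))
     / (b `^ b * (1 - b) `^ (1 - b)))%:E <= zeta_clique R k)%E.
Proof.
have k1 : 1 < k by apply: lt_le_trans hk.
have p0 : 0 < b - a by lra.
have p1 : b - a < 1 by lra.
have -> : 1 - b + a = 1 - (b - a) by ring.
rewrite !powR_nentropy // -expRN -expRD.
set V := expR _.
have mem1 : (1%:E <= zeta_clique R k)%E.
  apply: ereal_sup_ubound; exists 1 => //; exists (fun=> 0); first exact: cvg_cst.
  move=> n _; have [G [dG cG chG]] := @single_vertex_graph R n k k1.
  by exists G; split=> //; rewrite addr0 expr1n.
apply/lee_addgt0Pr => eps eps0.
rewrite -leeBlDr // -EFinB.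
have [z1|z1] := leP (V - eps) 1; first by apply: le_trans mem1; rewrite lee_fin.
(* Otherwise monotonicity of [nentropy] beyond 1/2 would give [V <= 1], the case already settled. *)
have p2 : b - a <= 1 / 2.
  rewrite leNgt; apply/negP => p2.
  have : V <= 1 by rewrite -expR0 ler_expR subr_le0 nentropy_le //; lra.
  lra.
(* The ceiling is at most [k - 1], so [b - a <= (k - 1) * (b ^ 2 - a)]; this rearranges to the
   claim. *)
have kp : (k - 1)%:~R * (b - b ^+ 2) <= ((k - 1)%:~R - 1) * (b - a).
  have : (b - a) / (b ^+ 2 - a) <= (k - 1)%:~R.
    by rewrite -ceil_le_int -ltzD1 subrK.
  by rewrite ler_pdivrMr; lra.
have [n0 hn0] := @distance_graphs_in_large_dimension R k a b (V - eps) hk ha0 hb0 hb1 hba p2 kp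
  (ltac:(lra)) (ltac:(rewrite gtrBl; exact: eps0)).
apply: ereal_sup_ubound; exists (V - eps) => //.
(* Below [n0] the correction makes the base 1, reached by a single vertex; from [n0] on it is 0. *)
exists (fun n => if (n < n0)%N then 1 - (V - eps) else 0).
  apply: (@cvg_near_cst _ _ _ _); exists n0 => // n /=; rewrite leqNgt => /negbTE ->.
  by [].
move=> n _; case: ltnP => nn0; last by rewrite addr0; apply: hn0.
have [G [dG cG chG]] := @single_vertex_graph R n k k1.
by exists G; split=> //; rewrite subrKC expr1n.
Qed.
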